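(* For every $d$-Cauchy sequence $\{g_k\}$ in $\mathcal{M}$, there exists an element $[g_\infty]\in\widehat{\mathcal{M}_f}$ such that $\{g_k\}$ $\omega$-subconverges to $[g_\infty]$.
   Context: $M$ is a closed, orientable, $n$-dimensional $C^\infty$ manifold. $\mathcal{S}$ is the Fréchet space of smooth symmetric $(0,2)$-tensor fields on $M$ and $\mathcal{M}\subset\mathcal{S}$ the open subset of smooth Riemannian metrics, so $T_{\tilde g}\mathcal{M}\cong\mathcal{S}$. The $L^2$ metric on $\mathcal{M}$ is the weak Riemannian metric $(h,k)_{\tilde g}=\int_M \mathrm{tr}(\tilde g^{-1}h\tilde g^{-1}k)\,d\mu_{\tilde g}$, and $d$ is its distance function (infimum of lengths of paths in $\mathcal{M}$), which is known to be a metric. Fix a reference metric $g\in\mathcal{M}$; ''nullset'' and ''almost everywhere'' refer to $\mu_g$. A semimetric is a (not necessarily continuous) section $\tilde g$ of $S^2T^*M$ that is positive semidefinite on each $T_xM$. Its deflated set is $X_{\tilde g}=\{x\in M: \tilde g(x)\text{ is not positive definite}\}$. A measurable semimetric $\tilde g$ induces the measure $\mu_{\tilde g}$ given locally by $\sqrt{\det\tilde g}\,dx^1\cdots dx^n$, and $\mathrm{Vol}(Y,\tilde g)=\int_Y d\mu_{\tilde g}$. Let $\mathcal{M}_m$ be the set of measurable semimetrics on $M$ and $\mathcal{M}_f\subset\mathcal{M}_m$ the subset of those with $\mathrm{Vol}(M,\tilde g)<\infty$. On $\mathcal{M}_m$ put $g_0\sim g_1$ iff $X_{g_0}$ and $X_{g_1}$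 differ at most by a nullset and $g_0(x)=g_1(x)$ for a.e. $x\in M\setminus(X_{g_0}\cup X_{g_1})$. Put $\widehat{\mathcal{M}_m}=\mathcal{M}_m/{\sim}$ and $\widehat{\mathcal{M}_f}=\mathcal{M}_f/{\sim}$. For a sequence $\{g_k\}\subset\mathcal{M}$ let $G_k=g^{-1}g_k$ and let $D_{\{g_k\}}=\{x\in M:\forall\delta>0\ \exists k\in\mathbb{N}\text{ with }\det G_k(x)<\delta\}$ be its deflated set. The sequence $\{g_k\}$ $\omega$-converges to $[g_\infty]\in\widehat{\mathcal{M}_m}$ if for every representative $g_\infty$: (1) $\{g_k\}$ is $d$-Cauchy; (2) $X_{g_\infty}$ and $D_{\{g_k\}}$ differ at most by a nullset; (3) $g_k(x)\to g_\infty(x)$ for a.e. $x\in M\setminus D_{\{g_k\}}$; (4) $\sum_{k=1}^\infty d(g_k,g_{k+1})<\infty$. A $d$-Cauchy sequence $\omega$-subconverges to $[g_\infty]$ if it has a subsequence that $\omega$-converges to $[g_\infty]$. *)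

(* Defs.v *)
From Stdlib Require List.
From HB Require Import structures.
From mathcomp Require Import all_boot all_order all_algebra.
From mathcomp Require Import all_classical all_reals all_analysis.

Set Implicit Arguments.
Unset Strict Implicit.
Unset Printing Implicit Defensive.
Import Order.TTheory GRing.Theory Num.Theory.
Import numFieldNormedType.Exports.

Local Open Scope classical_set_scope.
Local Open Scope ring_scope.

Section LebesgueMeasure.
Context {R : realType} {n : nat}.
Implicit Types (E : set 'rV[R]_n) (B : option ('rV[R]_n * 'rV[R]_n)).

(* [None] is the empty box; it is needed only when [n = 0], where every
   product box is the one-point space. *)
Definition box B : set 'rV[R]_n :=
  if B is Some (a, b) then [set x | forall i, a 0 i <= x 0 i <= b 0 i]
  else set0.

Definition box_volume B : R :=
  if B is Some (a, b) then \prod_i Num.max 0 (b 0 i - a 0 i) else 0.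

Definition lebesgue_outer E : \bar R :=
  ereal_inf [set (\sum_(k <oo) (box_volume (B k))%:E)%E |
    B in [set B : nat -> _ | E `<=` \bigcup_k box (B k)]].

Lemma box_volume_ge0 B : 0 <= box_volume B.
Proof.
case: B => [[a b]|//]; apply: prodr_ge0 => i _.
by rewrite le_max lexx.
Qed.

Local Open Scope ereal_scope.

Let outer_ge0 E : 0 <= lebesgue_outer E.
Proof.
apply: le_ereal_inf_tmp => x [B _ <-]; apply: nneseries_ge0 => k _ _.
by rewrite lee_fin box_volume_ge0.
Qed.

Let outer0 : lebesgue_outer set0 = 0.
Proof.
apply/eqP; rewrite eq_le outer_ge0 andbT; apply: ereal_inf_lbound.
by exists (fun=> None) => //; rewrite eseries0.
Qed.

Let le_outer : {homo lebesgue_outer : E F / E `<=` F >-> E <= F}.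
Proof.
move=> E F EF; apply: ereal_inf_le_tmp => x [B FB <-].
by exists B => //; exact: subset_trans FB.
Qed.

Let outer_sigma_subadditive : sigma_subadditive lebesgue_outer.
Proof.
move=> A; have [[i ioo]|] := pselect (exists i, lebesgue_outer (A i) = +oo).
  rewrite (eseries_pinfty _ _ ioo) ?leey// => k _.
  by rewrite -ltNye (lt_le_trans _ (outer_ge0 _)).
rewrite -forallNE => Aoo.
suff add2e (e : {posnum R}) : lebesgue_outer (\bigcup_k A k) <=
    \sum_(i <oo) lebesgue_outer (A i) + e%:num%:E.
  by apply/lee_addgt0Pr => _/posnumP[].
rewrite (le_trans _ (epsilon_trick _ _ _))//.
pose P k (B : nat -> option ('rV[R]_n * 'rV[R]_n)) :=
  A k `<=` \bigcup_j box (B j) /\ \sum_(j <oo) (box_volume (B j))%:E <=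
    lebesgue_outer (A k) + (e%:num / (2 ^ k.+1)%:R)%:E.
have [G PG] : {G & forall k, P k (G k)}.
  apply: (@choice _ _ P) => k; rewrite /P.
  have en1 : (0 < e%:num / (2 ^ k.+1)%:R)%R by [].
  have fA : lebesgue_outer (A k) \is a fin_num.
    by rewrite ge0_fin_numE// ltey; apply/eqP/Aoo.
  have [x [B AB xE] ltx] := lb_ereal_inf_adherent en1 fA.
  by exists B; split => //; rewrite xE; exact: ltW.
pose vol (ij : nat * nat) : \bar R := (box_volume (G ij.1 ij.2))%:E.
have vol_ge0 ij : 0 <= vol ij by rewrite lee_fin box_volume_ge0.
apply: (@le_trans _ _ (\esum_(i in setT) vol i)).
  apply: ereal_inf_lbound => /=.
  have /card_esym/ppcard_eqP[f] := card_nat2.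
  exists (fun k => G (f k).1 (f k).2).
    move=> t [i _ /(PG i).1[j _ Gijt]].
    by exists (f^-1%FUN (i, j)) => //=; rewrite invK ?inE.
  rewrite -[LHS]/(\sum_(k <oo | xpredT k) (vol \o f) k).
  rewrite -(esum_pred_image vol _ xpredT) ?[fun=> _]set_true//.
  by rewrite image_eq.
rewrite (_ : esum _ _ = \sum_(i <oo) \sum_(j <oo) vol (i, j)); last first.
  pose J : nat -> set (nat * nat) := fun i => [set (i, j) | j in setT].
  rewrite (_ : setT = \bigcup_k J k); last first.
    by rewrite predeqE => -[a b]; split => // _; exists a => //; exists b.
  rewrite esum_bigcupT //=; last first.
    apply/trivIsetP => i j _ _ ij.
    rewrite predeqE => -[k m] /=; split => //= -[] [_] _ [<-{k} _].
    by move=> [m' _] [] /esym/eqP; rewrite (negbTE ij).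
  rewrite -(image_id [set: nat]) -fun_true esum_pred_image//; last first.
    by move=> k _; exact: esum_ge0.
  apply: eq_eseriesr => /= j _.
  rewrite -(esum_pred_image vol (pair j) predT)//=; last first.
    by move=> ? ? _ _; exact: (@can_inj _ _ _ snd).
  by congr esum; rewrite predeqE => -[a b]; split; move=> [i _ <-]; exists i.
apply: lee_nneseries => i _; first by move=> ?; apply: nneseries_ge0.
exact: (PG i).2.
Qed.

HB.instance Definition _ := isOuterMeasure.Build R 'rV[R]_n lebesgue_outer
  outer0 outer_ge0 le_outer outer_sigma_subadditive.

End LebesgueMeasure.

(* R^n with the sigma-algebra of Lebesgue (i.e. Caratheodory) measurable sets. *)
Definition lebesgueR (R : realType) (n : nat) :=
  caratheodory_type (@lebesgue_outer R n).

Definition lebesgue (R : realType) (n : nat) : set (lebesgueR R n) -> \bar R :=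
  @lebesgue_outer R n.

HB.instance Definition _ (R : realType) (n : nat) :=
  isMeasure.Build _ (lebesgueR R n) R (@lebesgue R n)
    (@caratheodory_measure0 R _ (@lebesgue_outer R n))
    (@caratheodory_measure_ge0 R _ (@lebesgue_outer R n))
    (@caratheodory_measure_sigma_additive R _ (@lebesgue_outer R n)).

Section Smooth.
Context {R : realType} {n : nat}.

Definition partial (s : seq 'I_n) (f : 'rV[R]_n -> R) : 'rV[R]_n -> R :=
  foldr (fun i h => 'D_(delta_mx 0 i) h) f s.

Definition smooth_on (V : set 'rV[R]_n) (f : 'rV[R]_n -> R) :=
  forall s y, V y -> {for y, continuous (partial s f)} /\
    forall i, derivable (partial s f) y (delta_mx 0 i).

End Smooth.

(* The values of [coord] outside [dom], and of [point] outside the image of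
   [dom], are irrelevant. *)
Record chart (R : realType) (n : nat) (M : ptopologicalType) := Chart {
  dom : set M;
  coord : M -> 'rV[R]_n;
  point : 'rV[R]_n -> M;
  dom_open : open dom;
  codom_open : open (coord @` dom);
  coordK : forall x, dom x -> point (coord x) = x;
  coord_continuous : {within dom, continuous coord};
  point_continuous : {within coord @` dom, continuous point} }.

Section Manifold.
Context {R : realType} {n : nat} {M : ptopologicalType}.
Implicit Types (c : chart R n M) (A B : set (chart R n M)).

Definition transition c c' : 'rV[R]_n -> 'rV[R]_n := coord c' \o point c.

Definition smooth_transition c c' := forall j : 'I_n,
  smooth_on (coord c @` (dom c `&` dom c')) (fun y => transition c c' y 0 j).

Definition compatible c c' := smooth_transition c c' /\ smooth_transition c' c.

Definition charts_cover A := forall x, exists2 c, A c & dom c x.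

Definition smooth_structure A :=
  [/\ charts_cover A,
      forall c c', A c -> A c' -> compatible c c' &
      forall c, (forall c', A c' -> compatible c c') -> A c].

(* Jacobian matrix of the change of coordinates from [c] to [c'] at [x], acting
   on row vectors from the right: the entry (i, j) is the i-th partial
   derivative of the j-th new coordinate. *)
Definition jac c c' (x : M) : 'M[R]_n := 'J (transition c c') (coord c x).

Definition orientable A := exists B, [/\ B `<=` A, charts_cover B &
  forall c c' x, B c -> B c' -> dom c x -> dom c' x -> 0 < \det (jac c c' x)].

(* A section of S^2 T^*M is given by its component matrix in every chart;
   [g c x] is meaningful only if [c] is in the atlas and [x] in [dom c]. *)
Definition field := chart R n M -> M -> 'M[R]_n.

Implicit Types g h k : field.

Definition at_point A (P : chart R n M -> Prop) (x : M) :=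
  forall c, A c -> dom c x -> P c.

Definition eq_at A g h x := at_point A (fun c => g c x = h c x) x.

Definition section A g :=
  (forall c x, A c -> dom c x -> (g c x)^T = g c x) /\
  (forall c c' x, A c -> A c' -> dom c x -> dom c' x ->
     g c x = jac c c' x *m g c' x *m (jac c c' x)^T).

Definition pos_semidef (S : 'M[R]_n) :=
  forall v : 'rV[R]_n, 0 <= (v *m S *m v^T) 0 0.

Definition pos_def (S : 'M[R]_n) :=
  forall v : 'rV[R]_n, v != 0 -> 0 < (v *m S *m v^T) 0 0.

Definition component c (i j : 'I_n) g : 'rV[R]_n -> R :=
  fun y => g c (point c y) i j.

Definition smooth_section A g := section A g /\
  forall c i j, A c -> smooth_on (coord c @` dom c) (component c i j g).

Definition metric A g :=
  smooth_section A g /\ forall x, at_point A (fun c => pos_def (g c x)) x.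

Definition semimetric A g :=
  section A g /\ forall x, at_point A (fun c => pos_semidef (g c x)) x.

Definition deflated A g : set M :=
  [set x | ~ at_point A (fun c => pos_def (g c x)) x].

(* The value at [x] of a scalar computed in a chart around [x], for scalars
   which do not depend on the chart. *)
Definition in_chart A (F : chart R n M -> M -> R) (x : M) : R :=
  xget 0 [set r | exists c, [/\ A c, dom c x & r = F c x]].

Definition tr_prod A g h k : M -> R :=
  in_chart A (fun c x => \tr (invmx (g c x) *m h c x *m invmx (g c x) *m k c x)).

Definition det_rel A g h : M -> R :=
  in_chart A (fun c x => \det (invmx (g c x) *m h c x)).

Definition lebesgue_sets A : set (set M) := [set E | forall c, A c ->
  measurable (coord c @` (E `&` dom c) : set (lebesgueR R n))].

Definition lebM A := g_sigma_algebraType (lebesgue_sets A).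

Definition measurable_section A g := forall c i j, A c ->
  measurable_fun (dom c : set (lebM A)) (fun x => g c x i j).

(* A finite cover of [M] by compact subsets of coordinate domains; there is one
   as soon as [M] is compact. *)
Definition compact_cover A (s : seq (chart R n M * set M)) :=
  List.Forall (fun cK => [/\ A cK.1, compact cK.2 & cK.2 `<=` dom cK.1]) s /\
  forall x, List.Exists (fun cK => cK.2 x) s.

Definition the_cover A : seq (chart R n M * set M) :=
  if pselect (exists s, compact_cover A s) is left e then projT1 (cid e)
  else [::].

(* [E] is cut into the pieces E `&` K_i `\` (K_0 `|` .. `|` K_(i-1)), and on
   each piece sqrt (det g) dx^1 ... dx^n is integrated in the i-th chart.  By
   the change of variables formula the result depends neither on the cover nor
   on the charts. *)
Fixpoint volume_rec g (s : seq (chart R n M * set M)) (E : set M) : \bar R :=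
  if s is (c, K) :: s' then
    (\int[@lebesgue R n]_(y in coord c @` (E `&` K))
       (Num.sqrt (\det (g c (point c y))))%:E
     + volume_rec g s' (E `\` K))%E
  else 0%E.

Definition volume A g : set (lebM A) -> \bar R := volume_rec g (the_cover A).

Definition L2 A g h k : \bar R :=
  (\int[@volume A g]_x (tr_prod A g h k x)%:E)%E.

(* Convergence in the Frechet space of smooth sections: all partial derivatives
   of all components converge uniformly on compact subsets of charts. *)
Definition frechet_cvg A {T : Type} (F : set_system T) (hs : T -> field) h :=
  forall c (K : set 'rV[R]_n) (s : seq 'I_n) (i j : 'I_n) (e : R),
    A c -> compact K -> K `<=` coord c @` dom c -> 0 < e ->
    \forall t \near F, forall y, K y ->
      `|partial s (component c i j (hs t)) y - partial s (component c i j h) y|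
        < e.

Definition C1_on A (a b : R) (gam vel : R -> field) :=
  forall t, a <= t <= b ->
    [/\ metric A (gam t), smooth_section A (vel t),
        frechet_cvg A (within `[a, b] t^')
          (fun u c x => (u - t)^-1 *: (gam u c x - gam t c x)) (vel t) &
        frechet_cvg A (within `[a, b] (nbhs t)) vel (vel t)].

(* [p] lists, for the successive pieces of the parameter interval [a, 1], the
   right end point of the piece and the velocity of [gam] on it. *)
Fixpoint piecewise_C1 A (gam : R -> field) (a : R) (p : seq (R * (R -> field))) :=
  if p is (b, vel) :: p' then
    [/\ a < b, C1_on A a b gam vel & piecewise_C1 A gam b p']
  else a = 1.

Fixpoint path_length A (gam : R -> field) (a : R) (p : seq (R * (R -> field)))
    : \bar R :=
  if p is (b, vel) :: p' then
    (\int[@lebesgue_measure R]_(t in `[a, b])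
       sqrte (L2 A (gam t) (vel t) (vel t))
     + path_length A gam b p')%E
  else 0%E.

Definition dist A g h : \bar R :=
  ereal_inf [set l | exists gam p,
    [/\ piecewise_C1 A gam 0 p, forall x, eq_at A (gam 0) g x,
        forall x, eq_at A (gam 1) h x & l = path_length A gam 0 p]].

Definition Mm A : set field :=
  [set g | semimetric A g /\ measurable_section A g].

Definition Mf A : set field :=
  [set g | Mm A g /\ (@volume A g setT < +oo)%E].

(* In the rest of the file [g] is the reference metric. *)
Definition equivm A g : field -> field -> Prop := fun g0 g1 =>
  (@volume A g).-negligible (deflated A g0 `+` deflated A g1) /\
  {ae @volume A g, forall x,
     ~ (deflated A g0 `|` deflated A g1) x -> eq_at A g0 g1 x}.

Definition class A g (g0 : field) : set field :=
  [set g1 | Mm A g1 /\ equivm A g g0 g1].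

Definition Mm_hat A g : set (set field) := [set class A g g0 | g0 in Mm A].

(* A semimetric equivalent to one of finite volume has finite volume, so the
   class taken in [Mm] is the class taken in [Mf]. *)
Definition Mf_hat A g : set (set field) := [set class A g g0 | g0 in Mf A].

Definition dist_cauchy A (gs : nat -> field) :=
  forall e : R, 0 < e -> exists N : nat, forall m l : nat,
    (N <= m)%N -> (N <= l)%N -> (dist A (gs m) (gs l) < e%:E)%E.

Definition seq_deflated A g (gs : nat -> field) : set M :=
  [set x | forall delta : R, 0 < delta ->
     exists m : nat, det_rel A g (gs m) x < delta].

Definition omega_converges A g (gs : nat -> field) (C : set field) :=
  Mm_hat A g C /\ forall ginf, C ginf ->
  [/\ dist_cauchy A gs,
      (@volume A g).-negligible (deflated A ginf `+` seq_deflated A g gs),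
      {ae @volume A g, forall x, ~ seq_deflated A g gs x ->
         at_point A (fun c => gs m c x @[m --> \oo] --> ginf c x) x} &
      (\sum_(0 <= m <oo) dist A (gs m) (gs m.+1) < +oo)%E].

Definition omega_subconverges A g (gs : nat -> field) (C : set field) :=
  exists2 phi : nat -> nat, {homo phi : m l / (m < l)%N} &
    omega_converges A g (gs \o phi) C.

End Manifold.

(* Main.v *)
Require Import Defs.
From HB Require Import structures.
From mathcomp Require Import all_boot all_order all_algebra.
From mathcomp Require Import all_classical all_reals all_analysis.
From mathcomp Require Import perm measurable_realfun ring lra.
Require Import Defs.
Import Order.TTheory GRing.Theory Num.Theory.
Import numFieldNormedType.Exports.
Local Open Scope classical_set_scope.
Local Open Scope ring_scope.

(** Why the theorem holds.  A positive definite symmetric matrix [a] carries the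
norm [h |-> sqrt (tr (a^-1 h a^-1 h))] on symmetric matrices, and the L2 metric
integrates, against the fixed measure mu_g, the squares of the pointwise
speeds sqrt (tr ((a^-1 a')^2) * sqrt (det (g^-1 a))).  A Cauchy sequence has a
subsequence [g_k] joined by paths of metrics whose L2 lengths have a finite
sum.  Let theta (x) be the total pointwise length of all these paths at [x].
Tonelli's theorem and the Cauchy-Schwarz inequality bound the integral of
q * theta by the L2 norm of [q] times the sum of the lengths
([weighted_point_length_le]); with q = min (theta, N) and N going to infinity,
theta is square-integrable ([sum_square_integrable]), in particular finite
almost everywhere.

The rest is pointwise.  Along a path the fourth root of det (g^-1 a) is
Lipschitz with respect to the pointwise length ([root4_det_variation]).  Where
this fourth root stays above some d > 0, each [ln (u a u^T)] is Lipschitz too,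
with constant 1 / d ([quad_variation]).  Hence, where theta is finite and [x]
is not in the deflated set of the sequence, [u g_k u^T] converges to a positive
limit for every [u <> 0], so that [g_k(x)] converges to a positive definite
matrix ([posdef_seq_cvg]).  The limit semimetric is this limit, and 0 elsewhere:
its deflated set is the one of the sequence up to the null set where theta is
infinite.  Its volume density sqrt (det (g^-1 g_oo)) is at most
2 sqrt (det (g^-1 g_0)) + 2 n theta^2, which is integrable.

On the measure-theoretic side, every volume measure is mu_g with the density
sqrt (det (g^-1 h)) ([volume_measure]).  This is checked piece by piece on the
cover used to define volumes, with the same charts for [g] and [h], so that no
change of variables formula enters. *)

(** * Borel sets of the coordinate space *)

Section LebesgueBorel.
Context {R : realType} {n : nat}.
Implicit Types (i : 'I_n) (c : R) (B : option ('rV[R]_n * 'rV[R]_n)).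

Definition box_le i c B := if B is Some (a, b) then
  Some (a, \row_j (if j == i then Num.min (b 0 j) c else b 0 j)) else None.
Definition box_ge i c B := if B is Some (a, b) then
  Some (\row_j (if j == i then Num.max (a 0 j) c else a 0 j), b) else None.

Lemma box_volume_cut i c B :
  box_volume (box_le i c B) + box_volume (box_ge i c B) = box_volume B.
Proof.
case: B => [[a b]|] /=; last by rewrite addr0.
rewrite (bigD1 i) //= [X in _ + X](bigD1 i) //= [RHS](bigD1 i) //= !mxE !eqxx.
under eq_bigr => j /negbTE ji do rewrite !mxE ji.
under [X in _ + _ * X]eq_bigr => j /negbTE ji do rewrite !mxE ji.
rewrite -mulrDl; congr (_ * _).
rewrite /Num.max /Num.min; repeat case: ifPn; lra.
Qed.

(** Cutting every box of a cover along the hyperplane splits its volume exactly, so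
the outer measure is additive across the hyperplane. *)
Lemma halfspace_measurable i c :
  measurable ([set x | x 0 i <= c] : set (lebesgueR R n)).
Proof.
apply: le_caratheodory_measurable => X.
apply: le_ereal_inf_tmp => _ [B XB <-].
have -> : (\sum_(k <oo) (box_volume (B k))%:E =
   \sum_(k <oo) (box_volume (box_le i c (B k)))%:E +
   \sum_(k <oo) (box_volume (box_ge i c (B k)))%:E)%E.
  rewrite -nneseriesD => [|k _|k _]; rewrite ?lee_fin ?box_volume_ge0//.
  by apply: eq_eseriesr => k _; rewrite -EFinD box_volume_cut.
apply: leeD; apply: ereal_inf_lbound.
- exists (fun k => box_le i c (B k)) => //= x [Xx xc].
  have [k _ Bk] := XB x Xx; exists k => //.
  case: (B k) Bk => [[a b]|]//= abx j; rewrite mxE.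
  by case: eqP => [->|_]; rewrite ?le_min ?xc ?andbT; exact: abx.
- exists (fun k => box_ge i c (B k)) => //= x [Xx xc].
  have [k _ Bk] := XB x Xx; exists k => //.
  case: (B k) Bk => [[a b]|]//= abx j; rewrite mxE.
  have {xc} cx : c <= x 0 i by rewrite leNgt; apply/negP => /ltW.
  by case: eqP => [->|_]; rewrite ?ge_max ?cx ?andbT; exact: abx.
Qed.

Lemma coord_measurable i :
  measurable_fun [set: lebesgueR R n] (fun y : 'rV[R]_n => y 0 i : R).
Proof.
apply: (measurability _ (RGenOInfty.measurableE R)).
move=> _ [_ [c ->] <-]; rewrite setTI.
have -> : (fun y : 'rV[R]_n => y 0 i) @^-1` `]c, +oo[ = ~` [set x | x 0 i <= c].
  apply/seteqP; split=> x /=; rewrite in_itv /= andbT; first by rewrite ltNge => /negP.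
  by move=> /negP; rewrite -ltNge.
exact/measurableC/halfspace_measurable.
Qed.

Lemma rat_box_measurable (q : 'rV[rat]_n * 'rV[rat]_n) :
  measurable ([set x | forall i, ratr (q.1 0 i) < x 0 i < ratr (q.2 0 i)]
    : set (lebesgueR R n)).
Proof.
rewrite [X in measurable X](_ : _ = ~` \bigcup_i
  ((fun y : 'rV[R]_n => y 0 i : R) @^-1` ~` `]ratr (q.1 0 i), ratr (q.2 0 i)[)).
  apply/measurableC/countable_bigcupT_measurable => [|i]; first exact: countableP.
  rewrite -[X in measurable X]setTI; apply: coord_measurable => //.
  exact: measurableC.
apply/seteqP; split => x /=.
  by move=> xq [i _] /=; rewrite in_itv /= xq.
by move=> xq i; apply: contra_notT xq => /negP xq; exists i => //=; rewrite in_itv.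
Qed.

Lemma open_lebesgue_measurable (U : set 'rV[R]_n) :
  open U -> measurable (U : set (lebesgueR R n)).
Proof.
move=> oU.
pose D := [set q : 'rV[rat]_n * 'rV[rat]_n |
  [set x : 'rV[R]_n | forall i, ratr (q.1 0 i) < x 0 i < ratr (q.2 0 i)] `<=` U].
have -> : U = \bigcup_(q in D)
   [set x | forall i, ratr (q.1 0 i) < x 0 i < ratr (q.2 0 i)].
  apply/seteqP; split => [x Ux|x [q Dq] /Dq]//.
  have /nbhs_ballP[e /= e0 xeU] := open_nbhs_nbhs (conj oU Ux).
  have /choice[q xq] : forall i, exists q : rat * rat,
      x 0 i - e < ratr q.1 < x 0 i /\ x 0 i < ratr q.2 < x 0 i + e.
    move=> i; have [|p] := @rat_in_itvoo R (x 0 i - e) (x 0 i); first by rewrite gtrBl.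
    have [|r] := @rat_in_itvoo R (x 0 i) (x 0 i + e); first by rewrite ltrDl.
    by rewrite !in_itv /=; exists (p, r).
  exists (\row_i (q i).1, \row_i (q i).2).
    move=> y /= yq; apply: xeU; split=> // k i; rewrite ord1.
    have := yq i; rewrite !mxE /ball /= ltr_distlC.
    have [/andP[h1 h2] /andP[h3 h4] /andP[h5 h6]] := xq i.
    by apply/andP; split; lra.
  by move=> i; rewrite !mxE /=; have [/andP[_ ->] /andP[-> _]] := xq i.
rewrite bigcup_mkcond; apply: countable_bigcupT_measurable => [|q].
  exact: countableP.
case: ifP => [_|_]; [exact: (rat_box_measurable q)|exact: measurable0].
Qed.

Lemma lebesgue_bounded (E : set 'rV[R]_n) :
  bounded_set E -> (@lebesgue R n E < +oo)%E.
Proof.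
case=> m0 [_ m0E]; set m := m0 + 1; pose a : 'rV[R]_n := const_mx m.
have mE x : E x -> `|x| <= m by apply: m0E; rewrite ltrDl.
apply: (@le_lt_trans _ _ (box_volume (Some (-a, a)))%:E); last exact: ltry.
apply: ereal_inf_lbound.
exists (fun k => if k == 0%N then Some (-a, a) else None).
  move=> x /mE xm; exists 0%N => // i; rewrite !mxE -ler_norml.
  apply: le_trans xm; rewrite [leRHS]mx_normrE.
  by apply/bigmax_geP; right => /=; exists (ord0, i).
rewrite (nneseries_split 0 1)%N; last by move=> k _; rewrite lee_fin box_volume_ge0.
by rewrite big_nat1 eseries0 ?adde0// => -[].
Qed.

End LebesgueBorel.

(** * Positive definite matrices *)

Lemma sum_cauchy_schwarz (R : realFieldType) (I : finType) (x y : I -> R) :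
  (\sum_i x i * y i) ^+ 2 <= (\sum_i x i ^+ 2) * (\sum_i y i ^+ 2).
Proof.
rewrite -subr_ge0 -(pmulr_rge0 _ (ltr0Sn R 1)).
(* Lagrange's identity *)
suff -> : 2 * ((\sum_i x i ^+ 2) * (\sum_i y i ^+ 2) - (\sum_i x i * y i) ^+ 2)
    = \sum_i \sum_j (x i * y j - x j * y i) ^+ 2.
  by apply: sumr_ge0 => i _; apply: sumr_ge0 => j _; exact: sqr_ge0.
have E (F G : I -> R) : (\sum_i F i) * (\sum_i G i) = \sum_i \sum_j F i * G j.
  by rewrite mulr_suml; apply: eq_bigr => i _; rewrite mulr_sumr.
transitivity (\sum_i \sum_j x i ^+ 2 * y j ^+ 2 + \sum_i \sum_j y i ^+ 2 * x j ^+ 2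
   - 2 * (\sum_i \sum_j (x i * y i) * (x j * y j))).
  by rewrite -!E expr2; ring.
rewrite mulr_sumr -big_split -sumrB /=; apply: eq_bigr => i _.
rewrite mulr_sumr -big_split -sumrB /=; apply: eq_bigr => j _; ring.
Qed.

Section PosDef.
Context {R : realType} {n : nat}.
Implicit Types S V : 'M[R]_n.

Lemma pos_def_unit S : pos_def S -> S \in unitmx.
Proof.
move=> pS; rewrite unitmxE unitfE; apply/negP => /det0P[v v0 vS].
by have := pS v v0; rewrite vS mul0mx mxE ltxx.
Qed.

End PosDef.

(** Induction on the size: the Schur complement of the top left entry is again
positive definite. *)
Lemma cholesky (R : realType) n (S : 'M[R]_n) : S^T = S -> pos_def S ->
  exists2 p, p \in unitmx & S = p *m p^T.
Proof.
move=> sS pS; suff [p Sp] : exists p : 'M[R]_n, S = p *m p^T.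
  exists p => //; have := pos_def_unit S pS.
  by rewrite Sp unitmx_mul => /andP[].
elim: n S sS pS => [|n IH] S sS pS.
  by exists 0; apply/matrixP => -[].
move: S sS pS; rewrite -[n.+1]/(1 + n)%N => S sS pS.
(* S is the block matrix of al, r, r^T and its bottom right block. *)
pose al := S 0 0; pose r := ursubmx S.
have al_gt0 : 0 < al.
  have /pS : delta_mx 0 0 != 0 :> 'rV[R]_(1 + n).
    apply/eqP => /matrixP/(_ 0 0)/eqP.
    by rewrite !mxE !eqxx oner_eq0.
  by rewrite trmx_delta -rowE -colE !mxE.
have SE : S = block_mx al%:M r r^T (drsubmx S).
  rewrite -[LHS]submxK; congr block_mx.
    by apply/matrixP => i j; rewrite !ord1 !mxE; congr (S _ _); exact/val_inj.
  by rewrite /r trmx_ursub sS.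
pose T := drsubmx S - al^-1 *: (r^T *m r).
have sT : T^T = T.
  by rewrite /T linearB /= linearZ /= trmx_mul trmxK trmx_drsub sS.
have pT : pos_def T.
  (* w is v completed so as to be S-orthogonal to the first basis vector. *)
  move=> v v0; pose w : 'rV[R]_(1 + n) := row_mx (- al^-1 *: (v *m r^T)) v.
  have w0 : w != 0 by rewrite row_mx_eq0 negb_and v0 orbT.
  have := pS w w0; rewrite SE /w mul_row_block mul_mx_scalar scalerA mulrN.
  rewrite divff ?gt_eqF// scaleN1r addNr tr_row_mx mul_row_col mul0mx add0r.
  rewrite -scalemxAl scaleNr addrC -mulmxA scalemxAr -mulmxBr.
  by [].
have [p Tp] := IH T sT pT.
pose s := Num.sqrt al.
have ss : s * s = al by rewrite -expr2 sqr_sqrtr// ltW.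
have s0 : s != 0 by rewrite gt_eqF// sqrtr_gt0.
exists (block_mx s%:M 0 (s^-1 *: r^T) p).
rewrite tr_block_mx mulmx_block [LHS]SE; congr block_mx.
- by rewrite trmx0 mul0mx addr0 tr_scalar_mx -scalar_mxM ss.
- rewrite mul0mx addr0 linearZ /= trmxK -scalemxAr mul_scalar_mx scalerA.
  by rewrite mulVf// scale1r.
- by rewrite trmx0 mulmx0 addr0 tr_scalar_mx mul_mx_scalar scalerA divff// scale1r.
- rewrite linearZ /= trmxK -scalemxAl -scalemxAr scalerA -invfM ss -Tp.
  by rewrite addrC subrK.
Qed.

Section TraceForm.
Context {R : realType} {n : nat}.
Implicit Types S V : 'M[R]_n.

(** The squared norm of the tangent vector V at S in the space of positive definite
matrices, before multiplication by the volume density. *)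
Definition trace_form S V : R := \tr (invmx S *m V *m invmx S *m V).

(** With S = p p^T and V = p b p^T, the endomorphism S^-1 V is conjugate to the
symmetric matrix b.  This turns the inequalities below into Cauchy-Schwarz
inequalities for the entries of b. *)
Lemma trace_form_chol S V : S^T = S -> pos_def S -> V^T = V ->
  exists p b, [/\ p \in unitmx, S = p *m p^T, V = p *m b *m p^T,
    \tr (invmx S *m V) = \tr b & trace_form S V = \sum_(ij : 'I_n * 'I_n) b ij.1 ij.2 ^+ 2].
Proof.
move=> sS pS sV; have [p up Sp] := cholesky _ _ _ sS pS.
pose b := invmx p *m V *m invmx p^T.
have upt : p^T \in unitmx by rewrite unitmx_tr.
have Vb : V = p *m b *m p^T.
  by rewrite /b !mulmxA mulmxV// mul1mx -mulmxA mulVmx// mulmx1.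
have SV : invmx S *m V = invmx p^T *m b *m p^T.
  have -> : invmx S = invmx p^T *m invmx p.
    have uS : S \in unitmx by exact: pos_def_unit.
    rewrite -[RHS](mulmxK uS) -[LHS]mul1mx; congr (_ *m _).
    by rewrite [in RHS]Sp -!mulmxA (mulmxA (invmx p) p) mulVmx// mul1mx mulVmx.
  by rewrite {1}Vb -!mulmxA (mulmxA (invmx p) p) mulVmx// mul1mx.
have sb : b^T = b.
  by rewrite /b !trmx_mul sV !trmx_inv trmxK mulmxA.
clearbody b; exists p, b; split => //.
  by rewrite SV mxtrace_mulC mulmxA mulmxV// mul1mx.
rewrite /trace_form -mulmxA SV mxtrace_mulC !mulmxA.
rewrite -(mulmxA _ p^T) mulmxV// mulmx1 mxtrace_mulC !mulmxA mulmxV// mul1mx.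
rewrite /mxtrace -(pair_bigA _ (fun i j => b i j ^+ 2)) /=.
apply: eq_bigr => i _; rewrite mxE; apply: eq_bigr => j _.
by rewrite expr2 -{2}sb mxE.
Qed.

Lemma trace_form_ge0 S V : S^T = S -> pos_def S -> V^T = V -> 0 <= trace_form S V.
Proof.
move=> sS pS /(trace_form_chol S V sS pS)[p [b [_ _ _ _ ->]]].
by apply: sumr_ge0 => i _; exact: sqr_ge0.
Qed.

Lemma pos_def_det_gt0 S : S^T = S -> pos_def S -> 0 < \det S.
Proof.
move=> sS pS; have [p up ->] := cholesky _ _ _ sS pS.
by rewrite det_mulmx det_tr -expr2 exprn_even_gt0 //= -unitfE -unitmxE.
Qed.

Lemma trace_le S V : S^T = S -> pos_def S -> V^T = V ->
  `|\tr (invmx S *m V)| <= Num.sqrt n%:R * Num.sqrt (trace_form S V).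
Proof.
move=> sS pS sV; rewrite -sqrtrM// -sqrtr_sqr ler_sqrt//; last first.
  by rewrite mulr_ge0 ?trace_form_ge0.
have [p [b [_ _ _ -> ->]]] := trace_form_chol S V sS pS sV.
have := sum_cauchy_schwarz _ 'I_n (fun=> 1) (fun i => b i i).
under eq_bigr do rewrite mul1r.
under [X in _ <= X * _ -> _]eq_bigr do rewrite expr1n.
rewrite sumr_const card_ord; move/le_trans; apply.
rewrite ler_wpM2l// -(pair_bigA _ (fun i j => b i j ^+ 2)) /=.
apply: ler_sum => i _; rewrite (bigD1 i) //= lerDl.
by apply: sumr_ge0 => j _; exact: sqr_ge0.
Qed.

Lemma quad_le S V (u : 'rV[R]_n) : S^T = S -> pos_def S -> V^T = V ->
  `|(u *m V *m u^T) 0 0| <= (u *m S *m u^T) 0 0 * Num.sqrt (trace_form S V).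
Proof.
move=> sS pS sV.
have uSu : 0 <= (u *m S *m u^T) 0 0.
  have [->|/pS/ltW//] := eqVneq u 0.
  by rewrite mul0mx mul0mx mxE.
rewrite -[X in X * _](ger0_norm uSu) -[X in X * _]sqrtr_sqr -sqrtrM ?sqr_ge0//.
rewrite -[leLHS]sqrtr_sqr ler_sqrt//; last by rewrite mulr_ge0 ?sqr_ge0 ?trace_form_ge0.
have [p [b [_ -> -> _ ->]]] := trace_form_chol S V sS pS sV.
set w := u *m p.
have -> : u *m (p *m b *m p^T) *m u^T = w *m b *m w^T.
  by rewrite /w trmx_mul !mulmxA.
have -> : u *m (p *m p^T) *m u^T = w *m w^T.
  by rewrite /w trmx_mul !mulmxA.
have -> : (w *m b *m w^T) 0 0 = \sum_(ij : 'I_n * 'I_n) (w 0 ij.1 * w 0 ij.2) * b ij.1 ij.2.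
  rewrite -(pair_bigA _ (fun i j => w 0 i * w 0 j * b i j)) /= exchange_big /=.
  rewrite mxE; apply: eq_bigr => j _; rewrite [X in X * _]mxE mulr_suml.
  apply: eq_bigr => i _; rewrite !mxE; ring.
apply: le_trans (sum_cauchy_schwarz _ _ _ _) _.
rewrite le_eqVlt; apply/orP; left; apply/eqP; congr (_ * _).
rewrite -(pair_bigA _ (fun i j => (w 0 i * w 0 j) ^+ 2)) /= expr2 !mxE mulr_suml.
apply: eq_bigr => i _; rewrite mulr_sumr; apply: eq_bigr => j _; rewrite !mxE; ring.
Qed.

End TraceForm.

(** * Limits and determinants of matrices *)

Section MatrixLimits.
Context {R : realType} {T : Type} {F : set_system T} {FF : Filter F}.

Lemma cvg_mxP {m n} (M : T -> 'M[R]_(m, n)) (L : 'M[R]_(m, n)) :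
  M @ F --> L <-> forall i j, M t i j @[t --> F] --> L i j.
Proof.
split=> [ML i j|ML].
  exact: (cvg_comp _ _ ML (@matrix_normedtype.coord_continuous R m n i j L)).
move=> U [P LP PU].
have MP : \forall t \near F, forall ij : 'I_m * 'I_n, P ij.1 ij.2 (M t ij.1 ij.2).
  by apply: filter_forall => -[i j]; exact: (ML i j (P i j) (LP i j)).
by apply: filterS MP => t MtP; apply: PU => i j; exact: (MtP (i, j)).
Qed.

Lemma cvg_mulmx {m n p} (M : T -> 'M[R]_(m, n)) (N : T -> 'M[R]_(n, p))
    (L : 'M[R]_(m, n)) (K : 'M[R]_(n, p)) :
  M @ F --> L -> N @ F --> K -> M t *m N t @[t --> F] --> L *m K.
Proof.
move=> /cvg_mxP ML /cvg_mxP NK; apply/cvg_mxP => i j; rewrite mxE.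
under eq_fun do rewrite mxE.
by apply: cvg_big => [|k _]; [exact: add_continuous|exact: cvgM].
Qed.

Lemma cvg_mxtrace {n} (M : T -> 'M[R]_n) (L : 'M[R]_n) :
  M @ F --> L -> \tr (M t) @[t --> F] --> \tr L.
Proof.
by move=> /cvg_mxP ML; apply: cvg_big => [|k _]; [exact: add_continuous|].
Qed.

Lemma cvg_det {n} (M : T -> 'M[R]_n) (L : 'M[R]_n) :
  M @ F --> L -> \det (M t) @[t --> F] --> \det L.
Proof.
move=> /cvg_mxP ML; apply: cvg_big => [|s _]; first exact: add_continuous.
apply: cvgMl_tmp; apply: cvg_big => [|k _]; [exact: mul_continuous|exact: ML].
Qed.

Lemma cvg_invmx {n} (M : T -> 'M[R]_n) (L : 'M[R]_n) : L \in unitmx ->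
  M @ F --> L -> invmx (M t) @[t --> F] --> invmx L.
Proof.
move=> uL ML; have dL := uL; rewrite unitmxE unitfE in dL.
have : (\det (M t))^-1 *: \adj (M t) @[t --> F] --> invmx L.
  rewrite /invmx uL; apply/cvg_mxP => i j; rewrite !mxE.
  under eq_fun do rewrite !mxE.
  apply: cvgM; first by apply: cvgV => //; exact: cvg_det.
  apply: cvgMl_tmp; apply: cvg_det.
  apply/cvg_mxP => k l; rewrite !mxE; under eq_fun do rewrite !mxE.
  by move/cvg_mxP: ML; exact.
apply: cvg_trans; apply: near_eq_cvg.
have /cvgr_neq0/(_ dL) : \det (M t) @[t --> F] --> \det L by exact: cvg_det.
by apply: filterS => t dM; rewrite /invmx unitmxE unitfE dM.
Qed.

End MatrixLimits.

Section Jacobi.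
Context {R : realType}.

Lemma is_derive_prod (I : eqType) (r : seq I) (F : I -> R -> R) (dF : I -> R) (t : R) :
  uniq r -> (forall i, is_derive t 1 (F i) (dF i)) ->
  is_derive t 1 (fun u => \prod_(i <- r) F i u)
    (\sum_(i <- r) \prod_(j <- r) (if j == i then dF j else F j t)).
Proof.
move=> + dFt; elim: r => [_|a r IH /= /andP[ar ur]].
  rewrite big_nil (_ : (fun _ => _) = cst 1); first exact: is_derive_cst.
  by apply/funext => u; rewrite big_nil.
rewrite (_ : (fun u => _) = (F a : R -> R^o) * (fun u => \prod_(i <- r) F i u)); last first.
  by apply/funext => u; rewrite big_cons.
have dr := IH ur; have da := dFt a.
apply: is_derive_eq; rewrite /= big_cons big_cons eqxx addrC; congr (_ + _).
  rewrite mulrC; congr (_ * _); rewrite [LHS]big_seq [RHS]big_seq.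
  by apply: eq_bigr => j jr; case: eqP => // ja; rewrite -ja jr in ar.
rewrite scaler_sumr [LHS]big_seq [RHS]big_seq; apply: eq_bigr => i ir.
rewrite big_cons; case: eqP => // ai; by rewrite ai ir in ar.
Qed.

(** Jacobi's formula.  Differentiating the Leibniz expansion gives the sum over i of
the determinants of M with its i-th row replaced by that of V; expanding each
along that row gives the trace. *)
Lemma is_derive_det n (M : R -> 'M[R]_n) (V : 'M[R]_n) (t : R) :
  (forall i j, is_derive t 1 (fun u => M u i j) (V i j)) ->
  is_derive t 1 (fun u => \det (M u)) (\tr (\adj (M t) *m V)).
Proof.
move=> dM.
pose P i : 'M[R]_n := \matrix_(k, l) (if k == i then V k l else M t k l).
have -> : \tr (\adj (M t) *m V) = \sum_i \det (P i).
  rewrite mxtrace_mulC; apply: eq_bigr => i _.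
  rewrite mxE (expand_det_row _ i); apply: eq_bigr => j _.
  rewrite !mxE eqxx; congr (_ * (_ * \det _)).
  by apply/matrixP => k l; rewrite !mxE eq_sym (negbTE (neq_lift _ _)).
rewrite /determinant exchange_big /=.
rewrite (_ : (fun u => _) = \sum_(s : {perm 'I_n})
    (fun u => (-1) ^+ perm.odd_perm s * \prod_i M u i (s i))); last first.
  by apply/funext => u; rewrite fct_sumE.
have Ds (s : {perm 'I_n}) : is_derive t 1 (fun u => (-1) ^+ perm.odd_perm s * \prod_i M u i (s i))
    (\sum_i (-1) ^+ perm.odd_perm s * \prod_j P i j (s j)).
  have := @is_derive_prod 'I_n (index_enum 'I_n) (fun i u => M u i (s i)) (fun i => V i (s i)) t
    (index_enum_uniq _) (fun i => dM i (s i)).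
  set f := (fun u => _) : R -> R => D.
  rewrite (_ : (fun u => _) = ((-1) ^+ perm.odd_perm s) \*: f)//.
  apply: is_derive_eq.
  rewrite /= scaler_sumr; apply: eq_bigr => i _; congr (_ * _).
  by apply: eq_bigr => j _; rewrite mxE.
by elim/big_ind2 : _ => // [|] *; [exact: is_derive_cst|exact: is_deriveD].
Qed.

End Jacobi.

(** * Variation along paths of positive definite matrices *)

Section Variation.
Context {R : realType}.
Notation mu := (@lebesgue_measure R).

(** Both F + q and F - q are nondecreasing, where F is the primitive of f.  The bound
is by the integral over the whole interval, which is what the estimates at
intermediate times need. *)
Lemma variation_le (a b : R) (q dq f : R -> R) : a < b ->
  {within `[a, b], continuous f} -> {within `[a, b], continuous q} ->
  (forall t, a < t < b -> is_derive t 1 q (dq t)) ->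
  (forall t, a < t < b -> `|dq t| <= f t) ->
  forall s, a <= s <= b -> `|q s - q a| <= \int[mu]_(t in `[a, b]) f t.
Proof.
move=> ab cf cq dqE dqf s /andP[as_ sb].
have intf : mu.-integrable `[a, b] (EFin \o f).
  by apply: continuous_compact_integrable => //; exact: segment_compact.
pose F x := parameterized_integral mu a x f.
have cF : {within `[a, b], continuous F}.
  by apply: parameterized_integral_continuous => //; exact: ltW.
have dF t : a < t < b -> is_derive t 1 F (f t).
  move=> /andP[at_ tb].
  have cft : {for t, continuous f}.
    have : {within `]a, b[, continuous f}.
      by apply: continuous_subspaceW cf; exact: subset_itv_oo_cc.
    rewrite continuous_open_subspace; last exact: interval_open.
    by apply; rewrite inE /= in_itv /= at_ tb.
  have [d1 d2] := @continuous_FTC1_closed R f a t b tb intf at_ cft.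
  by apply: DeriveDef => //; rewrite -derive1E.
have incl (x y : R) : a <= x -> y <= b -> `[x, y] `<=` `[a, b].
  by move=> ax yb; apply: subset_itv; rewrite bnd_simp.
have Fa : F a = 0 by rewrite /F /parameterized_integral set_itv1 Rintegral_set1.
have FG (G dG : R -> R) x y : a <= x <= y -> y <= b ->
    {within `[a, b], continuous G} -> (forall t, a < t < b -> is_derive t 1 G (dG t)) ->
    (forall t, a < t < b -> 0 <= dG t) -> G x <= G y.
  move=> /andP[ax +] yb cG dGE dG0; rewrite le_eqVlt => /predU1P[->//|xy].
  have [t|c /andP[xc cy] GE] := @MVT R G dG x y xy _ (continuous_subspaceW (incl _ _ ax yb) cG).
    move=> /[!in_itv] /= /andP[xt ty]; apply: dGE.
    by rewrite (le_lt_trans ax xt) (lt_le_trans ty yb).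
  rewrite -subr_ge0 GE mulr_ge0 ?subr_ge0 ?(ltW xy)//; apply: dG0.
  by rewrite (le_lt_trans ax) ?(lt_le_trans _ yb)// (itvP xc).
have Fsb : F s <= F b.
  apply: (FG F f) => //; first by rewrite as_.
  by move=> t tab; exact: le_trans (dqf t tab).
apply: le_trans Fsb; rewrite ler_distl.
have cFN : {within `[a, b], continuous (F - q)}.
  by move=> x; apply: continuousB; [exact: cF|exact: cq].
have cFD : {within `[a, b], continuous (F + q)}.
  by move=> x; apply: continuousD; [exact: cF|exact: cq].
have := FG (F - q) (f - dq) a s _ sb cFN _ _.
have := FG (F + q) (f + dq) a s _ sb cFD _ _.
rewrite lexx as_ !fctE Fa /=.
move=> /(_ isT)/(_ (fun t tab => is_deriveD (dF t tab) (dqE t tab))).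
move=> h1 /(_ isT)/(_ (fun t tab => is_deriveB (dF t tab) (dqE t tab))) h2.
have {}h1 : 0 + q a <= F s + q s.
  by apply: h1 => t /dqf; rewrite ler_norml => /andP[+ _]; rewrite -subr_ge0 opprK addrC.
have {}h2 : 0 - q a <= F s - q s.
  by apply: h2 => t /dqf; rewrite ler_norml => /andP[_]; rewrite -subr_ge0.
by apply/andP; split; lra.
Qed.

End Variation.

Lemma cvg_sqrt (R : realType) (T : Type) (F : set_system T) (FF : Filter F)
    (f : T -> R) (l : R) :
  f @ F --> l -> Num.sqrt (f t) @[t --> F] --> Num.sqrt l.
Proof. by move=> fl; apply: (cvg_comp _ _ fl); exact: sqrt_continuous. Qed.

Section PosDefPath.
Context {R : realType} {n : nat}.
Notation mu := (@lebesgue_measure R).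
Implicit Types (S V : 'M[R]_n) (k : R) (u : 'rV[R]_n).

Definition quad u S : R := (u *m S *m u^T) 0 0.

(** The square root of the volume density sqrt (k det S).  The speed below is the norm
of S^-1 V times this root, which makes the root Lipschitz for the length; [k] is
the inverse of the determinant of the reference metric. *)
Definition root4_det k S : R := Num.sqrt (Num.sqrt (k * \det S)).

Definition mx_speed k S V : R :=
  Num.sqrt (trace_form S V * Num.sqrt (k * \det S)).

Lemma quadE u S : quad u S = \sum_j \sum_i u 0 i * u 0 j * S i j.
Proof.
rewrite /quad mxE; apply: eq_bigr => j _.
rewrite [X in X * _]mxE mulr_suml; apply: eq_bigr => i _; rewrite !mxE; ring.
Qed.

Lemma is_derive_quad u (m : R -> 'M[R]_n) V (t : R) :
  (forall i j, is_derive t 1 (fun s => m s i j) (V i j)) ->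
  is_derive t 1 (fun s => quad u (m s)) (quad u V).
Proof.
move=> dm; rewrite quadE.
rewrite (_ : (fun s => _) =
    \sum_j \sum_i ((u 0 i * u 0 j) \*: (fun s => m s i j : R^o))).
  by apply: is_derive_sum => j; apply: is_derive_sum => i; exact: is_deriveZ.
apply/funext => s; rewrite quadE fct_sumE; apply: eq_bigr => j _.
by rewrite fct_sumE.
Qed.

(** What a piece of a path of metrics becomes at a point of a chart; the derivative
is two-sided, hence restricted to interior times. *)
Record posdef_path (a b : R) (m v : R -> 'M[R]_n) := PosdefPath {
  path_lt : a < b ;
  path_sym : forall t, a <= t <= b -> (m t)^T = m t ;
  path_pos : forall t, a <= t <= b -> pos_def (m t) ;
  path_velsym : forall t, a <= t <= b -> (v t)^T = v t ;
  path_cont : {within `[a, b], continuous m} ;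
  path_velcont : {within `[a, b], continuous v} ;
  path_derive : forall t, a < t < b ->
    forall i j, is_derive t 1 (fun s => m s i j) (v t i j) }.

Variables (k : R) (k0 : 0 < k).

Lemma root4_det_gt0 S : S^T = S -> pos_def S -> 0 < root4_det k S.
Proof.
by move=> sS pS; rewrite !sqrtr_gt0 mulr_gt0// pos_def_det_gt0.
Qed.

Lemma mx_speedE S V : S^T = S -> pos_def S -> V^T = V ->
  mx_speed k S V = Num.sqrt (trace_form S V) * root4_det k S.
Proof. by move=> sS pS sV; rewrite /mx_speed sqrtrM// trace_form_ge0. Qed.

Lemma is_derive_root4_det (m : R -> 'M[R]_n) V (t : R) :
  (m t)^T = m t -> pos_def (m t) ->
  (forall i j, is_derive t 1 (fun s => m s i j) (V i j)) ->
  is_derive t 1 (fun s => root4_det k (m s)) (root4_det k (m t) * \tr (invmx (m t) *m V) / 4).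
Proof.
move=> sm pm dm; have d0 := pos_def_det_gt0 _ sm pm.
have dd := is_derive_det _ _ _ _ dm.
have kd0 : 0 < k * \det (m t) by rewrite mulr_gt0.
have dk : is_derive t 1 (fun s => k * \det (m s)) (k * \tr (\adj (m t) *m V)).
  rewrite (_ : (fun s => _) = k \*: (fun s => \det (m s) : R^o))//.
  exact: is_deriveZ.
have d1 := @is_derive1_comp R _ _ t _ _ (is_derive1_sqrt kd0) dk.
have s0 : 0 < Num.sqrt (k * \det (m t)) by rewrite sqrtr_gt0.
have d2 := @is_derive1_comp R _ _ t _ _ (is_derive1_sqrt s0) d1.
apply: (is_derive_eq d2).
have -> : \tr (\adj (m t) *m V) = \det (m t) * \tr (invmx (m t) *m V).
  rewrite /invmx unitmxE unitfE gt_eqF//= -scalemxAl linearZ /= mulrA divff ?gt_eqF//.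
  by rewrite mul1r.
rewrite /root4_det /=; set D := Num.sqrt (k * _); set r := Num.sqrt D.
have r0 : 0 < r by rewrite sqrtr_gt0.
have rD : r ^+ 2 = D by rewrite sqr_sqrtr// ltW.
have DD : D ^+ 2 = k * \det (m t) by rewrite sqr_sqrtr// ltW.
rewrite [k * (_ * _)]mulrA -DD -rD.
by field; rewrite gt_eqF.
Qed.

Lemma continuous_mx_speed (a b : R) (m v : R -> 'M[R]_n) : posdef_path a b m v ->
  {within `[a, b], continuous (fun t => mx_speed k (m t) (v t))}.
Proof.
move=> P; apply/subspace_continuousP => t tab.
have tab' : a <= t <= b by move: tab; rewrite /= in_itv.
have cm : m s @[s --> within `[a, b] (nbhs t)] --> m t.
  by have /subspace_continuousP := path_cont _ _ _ _ P; exact.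
have cv : v s @[s --> within `[a, b] (nbhs t)] --> v t.
  by have /subspace_continuousP := path_velcont _ _ _ _ P; exact.
have ci : invmx (m s) @[s --> within `[a, b] (nbhs t)] --> invmx (m t).
  by apply: cvg_invmx => //; apply: pos_def_unit; exact: (path_pos _ _ _ _ P).
apply: cvg_sqrt.
apply: cvgM.
  by apply: cvg_mxtrace; do ! apply: cvg_mulmx.
apply: cvg_sqrt.
by apply: cvgMl_tmp; exact: cvg_det.
Qed.

Definition mx_length (a b : R) (m v : R -> 'M[R]_n) : R :=
  \int[mu]_(t in `[a, b]) mx_speed k (m t) (v t).

Lemma continuous_root4_det (T : Type) (F : set_system T) (FF : Filter F)
   (m : T -> 'M[R]_n) S :
  m @ F --> S -> root4_det k (m t) @[t --> F] --> root4_det k S.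
Proof.
move=> mS; apply: cvg_sqrt.
apply: cvg_sqrt.
by apply: cvgMl_tmp; exact: cvg_det.
Qed.

(** The logarithmic derivative of the root is tr (m^-1 v) / 4, at most sqrt n times
the norm of m^-1 v. *)
Lemma root4_det_variation (a b : R) (m v : R -> 'M[R]_n) : posdef_path a b m v ->
  forall s, a <= s <= b ->
  `|root4_det k (m s) - root4_det k (m a)| <= Num.sqrt n%:R * mx_length a b m v.
Proof.
move=> P s sab.
have tab t : a < t < b -> a <= t <= b by move=> /andP[/ltW -> /ltW ->].
rewrite /mx_length -RintegralZl//; last first.
  apply: continuous_compact_integrable; first exact: segment_compact.
  exact: continuous_mx_speed.
apply: (variation_le _ _ (fun t => root4_det k (m t)) _ _ _ _ _ _ _ s sab).
- exact: (path_lt _ _ _ _ P).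
- move=> t; apply: cvgMl_tmp; exact: (continuous_mx_speed _ _ _ _ P).
- apply/subspace_continuousP => t tab'; apply: continuous_root4_det.
  by have /subspace_continuousP := path_cont _ _ _ _ P; exact.
- move=> t /[dup] /tab tab' tab''; apply: is_derive_root4_det.
  + exact: (path_sym _ _ _ _ P).
  + exact: (path_pos _ _ _ _ P).
  + exact: (path_derive _ _ _ _ P).
- move=> t /tab tab'; have sm := path_sym _ _ _ _ P t tab'.
  have pm := path_pos _ _ _ _ P t tab'; have sv := path_velsym _ _ _ _ P t tab'.
  have vp := root4_det_gt0 _ sm pm.
  rewrite mx_speedE// -mulrA normrM (gtr0_norm vp) mulrA [leRHS]mulrC ler_pM2l//.
  rewrite normrM; apply: le_trans (trace_le _ _ sm pm sv).
  by rewrite ler_piMr// ger0_norm//; lra.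
Qed.

(** The derivative of ln (u m u^T) is at most the norm of m^-1 v, which is the speed
divided by the root, hence at most d^-1 times the speed. *)
Lemma quad_variation (a b : R) (m v : R -> 'M[R]_n) (d : R) u :
  posdef_path a b m v -> u != 0 -> 0 < d ->
  (forall t, a <= t <= b -> d <= root4_det k (m t)) ->
  `|ln (quad u (m b)) - ln (quad u (m a))| <= d^-1 * mx_length a b m v.
Proof.
move=> P u0 d0 dm.
have tab t : a < t < b -> a <= t <= b by move=> /andP[/ltW -> /ltW ->].
have q0 t : a <= t <= b -> 0 < quad u (m t) by move=> /(path_pos _ _ _ _ P); exact.
rewrite /mx_length -RintegralZl//; last first.
  apply: continuous_compact_integrable; first exact: segment_compact.
  exact: continuous_mx_speed.
apply: (variation_le _ _ (fun t => ln (quad u (m t)))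
  (fun t => (quad u (m t))^-1 * quad u (v t)) _ _ _ _ _ _ b).
- exact: (path_lt _ _ _ _ P).
- move=> t; apply: cvgMl_tmp; exact: (continuous_mx_speed _ _ _ _ P).
- apply/subspace_continuousP => t tab'.
  have cm : m s @[s --> within `[a, b] (nbhs t)] --> m t.
    by have /subspace_continuousP := path_cont _ _ _ _ P; exact.
  have : u *m m s *m u^T @[s --> within `[a, b] (nbhs t)] --> u *m m t *m u^T.
    by apply: cvg_mulmx; [apply: cvg_mulmx => //|]; exact: cvg_cst.
  move=> /cvg_mxP/(_ 0 0) cq; apply: (cvg_comp _ _ cq).
  by apply: continuous_ln; apply: q0; move: tab'; rewrite /= in_itv.
- move=> t /[dup] /tab tab' tab''.
  have dq := is_derive_quad u m (v t) t (path_derive _ _ _ _ P t tab'').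
  exact: (is_derive1_comp (is_derive1_ln (q0 t tab')) dq).
- move=> t /tab tab'; have sm := path_sym _ _ _ _ P t tab'.
  have pm := path_pos _ _ _ _ P t tab'; have sv := path_velsym _ _ _ _ P t tab'.
  have := quad_le _ _ u sm pm sv; rewrite -!/(quad _ _) => qle.
  have qt := q0 t tab'.
  rewrite normrM normfV (gtr0_norm qt) mx_speedE//.
  rewrite ler_pdivrMl//; apply: le_trans qle _; rewrite ler_pM2l//.
  by rewrite mulrCA ler_peMr ?sqrtr_ge0// ler_pdivlMl// mulr1 dm.
- by rewrite lexx ltW//; exact: (path_lt _ _ _ _ P).
Qed.

End PosDefPath.

(** * Sequences of positive definite matrices *)

Section PosDefSequence.
Context {R : realType} {n : nat}.
Implicit Types (S : 'M[R]_n) (u : 'rV[R]_n).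

Lemma quadD u w S : S^T = S ->
  quad (u + w) S = quad u S + quad w S + 2 * (u *m S *m w^T) 0 0.
Proof.
move=> sS; have E : (w *m S *m u^T) 0 0 = (u *m S *m w^T) 0 0.
  have : (u *m S *m w^T)^T = w *m S *m u^T by rewrite !trmx_mul trmxK sS mulmxA.
  by move=> <-; rewrite mxE.
have D (a b c d : 'M[R]_1) : (a + b + (c + d)) 0 0 = a 0 0 + b 0 0 + (c 0 0 + d 0 0).
  by rewrite !mxE.
rewrite /quad linearD /= mulmxDl mulmxDr !mulmxDl D E; ring.
Qed.

Lemma polarization S i j : S^T = S ->
  S i j = (quad (delta_mx 0 i + delta_mx 0 j) S
           - quad (delta_mx 0 i) S - quad (delta_mx 0 j) S) / 2.
Proof.
move=> sS; rewrite quadD// -rowE trmx_delta -colE !mxE; by field.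
Qed.

(** What a path of length r from S to S' gives: the second bound needs the root to be
at least d along the path, which holds as soon as it exceeds d by sqrt n * r at
its origin. *)
Definition step_bound k S S' (r : R) :=
  `|root4_det k S' - root4_det k S| <= Num.sqrt n%:R * r /\
  forall u d, u != 0 -> 0 < d -> d + Num.sqrt n%:R * r <= root4_det k S ->
    `|ln (quad u S') - ln (quad u S)| <= d^-1 * r.

(** Once the steps are so short that the root cannot fall below d / 2 on the way, the
increments are dominated by the summable 2 / d * r. *)
Lemma ln_quad_cvg k (S_ : nat -> 'M[R]_n) (r : nat -> R) (th d : R) u :
  (forall j, step_bound k (S_ j) (S_ j.+1) (r j)) ->
  (forall j, 0 <= r j) -> (forall N, \sum_(0 <= j < N) r j <= th) ->
  0 < d -> (forall j, d <= root4_det k (S_ j)) -> u != 0 ->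
  cvgn (fun j => ln (quad u (S_ j))).
Proof.
move=> st r0 rth d0 dS u0.
have cr : cvgn (series r).
  apply: nondecreasing_is_cvgn; last by exists th => _ [N _ <-]; exact: rth.
  by apply: nondecreasing_series => j _ _; exact: r0.
have rc0 : Num.sqrt n%:R * r j @[j --> \oo] --> Num.sqrt n%:R * 0.
  by apply: cvgMl_tmp; exact: cvg_series_cvg_0.
(* d / 2 of the margin d pays for the variation within one step. *)
have [K _ HK] : \forall j \near \oo, Num.sqrt n%:R * r j <= d / 2.
  rewrite mulr0 in rc0; have d2 : 0 < d / 2 by rewrite divr_gt0.
  by apply: filterS (cvgr_lt 0 rc0 _ d2) => j /ltW.
pose l j := ln (quad u (S_ (j + K)%N)).
pose a j := l j.+1 - l j.
have aE : l = (fun j => l 0%N + series a j).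
  by apply/funext => j; rewrite /series /= telescope_sumr// addrC subrK.
have a0 j : 0 <= `|a j| by [].
have v0 j : 0 <= (d / 2)^-1 * r (j + K)%N by rewrite mulr_ge0// invr_ge0 divr_ge0// ltW.
have av j : `|a j| <= (d / 2)^-1 * r (j + K)%N.
  have [_] := st (j + K)%N; rewrite -addSn; apply => //; first by rewrite divr_gt0.
  apply: le_trans (dS _); rewrite [leRHS](splitr d) lerD2l.
  by apply: HK => /=; exact: leq_addl.
have cv : cvgn (series (fun j => (d / 2)^-1 * r (j + K)%N)).
  rewrite (_ : (fun j => _) = (d / 2)^-1 *: (fun j => r (j + K)%N))//.
  apply: is_cvg_seriesZ.
  apply: nondecreasing_is_cvgn.
    by apply: nondecreasing_series => j _ _; exact: r0.
  exists th => _ [N _ <-]; apply: le_trans (rth (N + K)%N).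
  rewrite /series /= [leRHS](@big_cat_nat _ _ _ K) ?leq_addl//= -[leLHS]add0r.
  apply: lerD; first by apply: sumr_ge0.
  by rewrite -{2}(add0n K) big_addn addnK.
have ca : cvgn (series a).
  by apply: normed_cvg; exact: (series_le_cvg a0 v0 av cv).
have /cvg_ex[x lx] : cvgn l.
  by rewrite aE; apply: is_cvgD; [exact: is_cvg_cst|].
by apply/cvg_ex; exists x; rewrite -(cvg_shiftn K).
Qed.

(** Positive limits of all the u S u^T are enough: the entries are recovered by
polarization, and positivity of the limits is positive definiteness. *)
Lemma posdef_seq_cvg k (S_ : nat -> 'M[R]_n) (r : nat -> R) (th d : R) :
  (forall j, (S_ j)^T = S_ j) -> (forall j, pos_def (S_ j)) ->
  (forall j, step_bound k (S_ j) (S_ j.+1) (r j)) ->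
  (forall j, 0 <= r j) -> (forall N, \sum_(0 <= j < N) r j <= th) ->
  0 < d -> (forall j, d <= root4_det k (S_ j)) ->
  exists L, [/\ S_ @ \oo --> L, L^T = L, pos_def L &
    root4_det k L <= root4_det k (S_ 0%N) + Num.sqrt n%:R * th].
Proof.
move=> sS pS st r0 rth d0 dS.
have qc u : u != 0 -> exists2 l : R, 0 < l & quad u (S_ j) @[j --> \oo] --> l.
  move=> u0; have := ln_quad_cvg _ _ _ _ _ u st r0 rth d0 dS u0.
  move=> /cvg_ex[l /= lc]; exists (expR l); first exact: expR_gt0.
  have -> : (fun j => quad u (S_ j)) = (fun j => expR (ln (quad u (S_ j)))).
    by apply/funext => j; rewrite lnK// posrE; exact: (pS j u u0).
  by apply: (cvg_comp _ _ lc); exact: continuous_expR.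
have delta_neq0 i : delta_mx 0 i != 0 :> 'rV[R]_n.
  by apply/eqP => /matrixP/(_ 0 i)/eqP; rewrite !mxE !eqxx oner_eq0.
have deltaD_neq0 i j : delta_mx 0 i + delta_mx 0 j != 0 :> 'rV[R]_n.
  apply/eqP => /matrixP/(_ 0 i)/eqP; rewrite !mxE !eqxx /=.
  by rewrite -natrD pnatr_eq0.
pose q u := lim (quad u (S_ j) @[j --> \oo]).
have qE u : u != 0 -> quad u (S_ j) @[j --> \oo] --> q u.
  by move=> /qc[l _ lc]; apply/cvg_ex; exists l.
pose L : 'M[R]_n := \matrix_(i, j)
  ((q (delta_mx 0 i + delta_mx 0 j) - q (delta_mx 0 i) - q (delta_mx 0 j)) / 2).
have SL : S_ @ \oo --> L.
  apply/cvg_mxP => i j; rewrite mxE; under eq_fun do rewrite polarization//.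
  by apply: cvgMr_tmp; apply: cvgB; [apply: cvgB|]; apply: qE.
exists L; split => //.
- by apply/matrixP => i j; rewrite !mxE (addrC (delta_mx 0 j)) addrAC.
- move=> u u0; have [l l0 lc] := qc u u0.
  suff -> : (u *m L *m u^T) 0 0 = l by [].
  have uSu : u *m S_ j *m u^T @[j --> \oo] --> u *m L *m u^T.
    by apply: cvg_mulmx; [apply: cvg_mulmx => //|]; exact: cvg_cst.
  exact: (cvg_unique (@Rhausdorff R) (proj1 (cvg_mxP _ _) uSu 0 0) lc).
- have vL : root4_det k (S_ j) @[j --> \oo] --> root4_det k L by exact: continuous_root4_det.
  apply: (cvgr_to_le vL); apply: nearW => N.
  have vN : root4_det k (S_ N) <= root4_det k (S_ 0%N) + Num.sqrt n%:R * \sum_(0 <= j < N) r j.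
    elim: N => [|N IH]; first by rewrite big_geq// mulr0 addr0.
    rewrite big_nat_recr//= mulrDr addrA.
    have [+ _] := st N; rewrite ler_distl => /andP[_ h].
    by apply: le_trans h _; rewrite lerD2r.
  by apply: le_trans vN _; rewrite lerD2l ler_wpM2l ?sqrtr_ge0.
Qed.

End PosDefSequence.

(** * Measures with a density *)

Section Density.
Context {d d' : measure_display} {X : measurableType d} {Y : measurableType d'}
  {R : realType} (lam : {measure set X -> \bar R}) (S : set X)
  (phi : X -> Y) (w : X -> R).

(** The image under phi of the measure w lam restricted to S.  Measurability on S alone is
what the inverse of a chart satisfies on the image of a piece of the cover. *)
Definition density_pushforward (mS : measurable S) (mphi : measurable_fun S phi)
  (mw : measurable_fun S w) (w0 : forall x, 0 <= w x) (E : set Y) : \bar R :=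
  (\int[lam]_(x in S `&` phi @^-1` E) (w x)%:E)%E.

Variables (mS : measurable S) (mphi : measurable_fun S phi)
  (mw : measurable_fun S w) (w0 : forall x, 0 <= w x).

Local Notation nu := (density_pushforward mS mphi mw w0).

Let nu0 : nu set0 = 0%E.
Proof. by rewrite /density_pushforward preimage_set0 setI0 integral_set0. Qed.

Let nu_ge0 E : (0 <= nu E)%E.
Proof. by apply: integral_ge0 => x _; rewrite lee_fin. Qed.

Let nu_sigma_additive : semi_sigma_additive nu.
Proof.
move=> F mF tF mUF.
have mSF k : measurable (S `&` phi @^-1` F k) by exact: mphi.
have -> : nu (\bigcup_k F k) = (\sum_(k <oo) nu (F k))%E.
  rewrite /density_pushforward preimage_bigcup setI_bigcupr.
  rewrite ge0_integral_bigcup//.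
  - apply/measurable_EFinP; apply: measurable_funS mw => //.
    by move=> x [k _ []].
  - by move=> x _; rewrite lee_fin.
  - apply/trivIsetP => i j _ _ ij; move/trivIsetP: tF => /(_ i j I I ij) Fij.
    apply/seteqP; split => // x [[_ Fi] [_ Fj]].
    by have : (F i `&` F j) (phi x) by []; rewrite Fij.
by apply: is_cvg_nneseries => k _ _; exact: nu_ge0.
Qed.

HB.instance Definition _ := isMeasure.Build _ Y R nu nu0 nu_ge0 nu_sigma_additive.

Import HBNNSimple.

Lemma integral_density_pushforward (F : Y -> \bar R) :
  measurable_fun setT F -> (forall y, 0 <= F y)%E ->
  (\int[nu]_y F y = \int[lam]_(x in S) (F (phi x) * (w x)%:E))%E.
Proof.
move=> mF F0; pose h := nnsfun_approx measurableT mF.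
have hF y : EFin \o h ^~ y @ \oo --> F y by exact: cvg_nnsfun_approx.
have mhphi k : measurable_fun S (fun x => h k (phi x)).
  exact: (measurable_comp measurableT).
have mwE : measurable_fun S (fun x => (w x)%:E) by exact/measurable_EFinP.
transitivity (limn (fun k => \int[nu]_y (h k y)%:E)%E).
  rewrite -monotone_convergence//.
  - by apply: eq_integral => y _; apply/esym/cvg_lim => //; exact: hF.
  - by move=> k; exact/measurable_EFinP.
  - by move=> k y _; rewrite lee_fin.
  - by move=> y _ k l kl; rewrite lee_fin; exact/lefP/nd_nnsfun_approx.
transitivity (limn (fun k => \int[lam]_(x in S) ((h k (phi x))%:E * (w x)%:E))%E); last first.
  rewrite -monotone_convergence//.
  - apply: eq_integral => x _; apply/cvg_lim => //.
    by apply: cvgeZr => //; exact: hF.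
  - by move=> k; apply: emeasurable_funM => //; exact/measurable_EFinP.
  - by move=> k x _; rewrite -EFinM lee_fin mulr_ge0.
  - move=> x _ k l kl; rewrite -!EFinM lee_fin ler_wpM2r//.
    exact/lefP/nd_nnsfun_approx.
apply/congr_lim/funext => k.
have mhk r : measurable (h k @^-1` [set r]).
  by rewrite -[X in measurable X]setTI; exact: measurable_funP.
transitivity (\sum_(r \in range (h k)) r%:E * nu (h k @^-1` [set r]))%E.
  by rewrite integralT_nnsfun sintegralE.
transitivity (\int[lam]_(x in S) \sum_(r \in range (h k))
    ((r * \1_(h k @^-1` [set r]) (phi x))%:E * (w x)%:E))%E; last first.
  apply: eq_integral => x _.
  rewrite -ge0_mule_fsuml; last by move=> r; exact: nnfun_muleindic_ge0.
  by rewrite fsumEFin// -(fimfunE _ (phi x)).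
rewrite ge0_integral_fsum//; last 2 first.
- move=> r; apply: emeasurable_funM => //; apply/measurable_EFinP.
  apply: measurable_funM => //.
  exact: (measurable_comp measurableT).
- by move=> r x _; rewrite mule_ge0 ?nnfun_muleindic_ge0// lee_fin.
apply: eq_fsbigr => r /[!inE] -[y _ <-].
under [RHS]eq_integral do rewrite EFinM -muleA.
rewrite ge0_integralZl//.
- congr (_ * _)%E; rewrite /density_pushforward integral_mkcondr.
  apply: eq_integral => x _; rewrite patchE /= indicE.
  set B := h k @^-1` _.
  have -> : (x \in phi @^-1` B) = (phi x \in B) by apply/idP/idP; rewrite !inE.
  by case: (_ \in _); rewrite ?mul1e ?mul0e.
- apply: emeasurable_funM => //; apply/measurable_EFinP.
  exact: (measurable_comp measurableT).
- by move=> x _; rewrite -EFinM lee_fin mulr_ge0.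
- by rewrite lee_fin.
Qed.

End Density.

(** * Measurability and change of charts *)

Section ManifoldBorel.
Context {R : realType} {n : nat} {M : ptopologicalType} (A : set (chart R n M)).
Implicit Types (c : chart R n M) (E U : set M).

Lemma image_coord c E :
  coord c @` (E `&` dom c) = coord c @` dom c `&` point c @^-1` E.
Proof.
apply/seteqP; split=> [_ [x [Ex cx] <-]|_ [[x cx <-]]].
  by split; [exists x|rewrite /= coordK].
by rewrite /= coordK// => Ex; exists x.
Qed.

Lemma codom_measurable c : measurable (coord c @` dom c : set (lebesgueR R n)).
Proof. exact/open_lebesgue_measurable/codom_open. Qed.

(** So the sigma-algebra generated by these sets adds nothing to them. *)
Lemma lebesgue_sets_sigma_algebra : sigma_algebra setT (lebesgue_sets A).
Proof.
split=> [c Ac|E mE c Ac|F mF c Ac].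
- by rewrite set0I image_set0.
- rewrite setTD image_coord preimage_setC -setDE.
  rewrite -[X in measurable X]set0U -(setDv (coord c @` dom c)) -setDIr -image_coord.
  by apply: measurableD; [exact: codom_measurable|exact: mE].
- rewrite setI_bigcupl image_bigcup; apply: bigcupT_measurable => k.
  exact: mF.
Qed.

Lemma measurable_lebM E : measurable (E : set (lebM A)) <-> lebesgue_sets A E.
Proof.
split=> [mE|mE]; last exact: sub_sigma_algebra.
by apply: mE; split; [exact: lebesgue_sets_sigma_algebra|].
Qed.

Lemma open_measurable_lebM U : open U -> measurable (U : set (lebM A)).
Proof.
move=> oU; apply/measurable_lebM => c Ac; rewrite image_coord.
apply: open_lebesgue_measurable; rewrite openE => y [cy Uy].
have pc : {for y, continuous (point c)}.
  have := @point_continuous _ _ _ c.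
  by rewrite continuous_open_subspace; [apply; rewrite inE|exact: codom_open].
apply: filterI; first by apply: open_nbhs_nbhs; split => //; exact: codom_open.
apply: pc; exact: open_nbhs_nbhs.
Qed.

Lemma continuous_measurable_lebM U (f : M -> R) : open U ->
  {in U, continuous f} -> measurable_fun (U : set (lebM A)) f.
Proof.
move=> oU cf; apply: (measurability _ (RGenOpens.measurableE R)).
move=> _ [_ [a [b ->] <-]]; apply: open_measurable_lebM.
rewrite openE => x [Ux fx]; apply: filterI.
  by apply: open_nbhs_nbhs.
apply: cf; first by rewrite inE.
by apply: open_nbhs_nbhs; split => //; exact: interval_open.
Qed.

(** Measurability of a set only concerns its traces on the chart domains. *)
Lemma measurable_fun_charts d (T : measurableType d) (f : M -> T) :
  (forall c, A c -> measurable_fun (dom c : set (lebM A)) f) ->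
  measurable_fun ([set: M] : set (lebM A)) f.
Proof.
move=> mf _ B mB; rewrite setTI; apply/measurable_lebM => c Ac.
have mc := open_measurable_lebM _ (dom_open c).
have /measurable_lebM/(_ c Ac) := mf c Ac mc B mB.
by rewrite setIAC setIid setIC.
Qed.

Lemma measurable_point c (K : set M) : A c -> K `<=` dom c ->
  measurable (K : set (lebM A)) ->
  measurable (coord c @` K : set (lebesgueR R n)) /\
  measurable_fun (coord c @` K : set (lebesgueR R n)) (point c : _ -> lebM A).
Proof.
move=> Ac Kc mK.
have imE E : coord c @` K `&` point c @^-1` E = coord c @` ((E `&` K) `&` dom c).
  rewrite image_coord; apply/seteqP; split => [y [[x Kx <-]]|y [[x cx <-]]].
    rewrite /= coordK//; last exact: Kc.
    by move=> Ex; split; [exists x => //; exact: Kc|].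
  by rewrite /= coordK// => -[Ex Kx]; split => //; exists x.
split.
  move/measurable_lebM : mK => /(_ c Ac); suff -> : K `&` dom c = K by [].
  exact/setIidPl.
move=> _ E mE; rewrite imE.
by move/measurable_lebM: (measurableI _ _ mE mK); apply.
Qed.

End ManifoldBorel.

Section ChartScalars.
Context {R : realType} {n : nat} {M : ptopologicalType} (A : set (chart R n M)).
Implicit Types (c : chart R n M) (g h k : @field R n M).

Lemma in_chartE (F : chart R n M -> M -> R) c (x : M) : A c -> dom c x ->
  (forall c', A c' -> dom c' x -> F c' x = F c x) -> in_chart A F x = F c x.
Proof.
move=> Ac cx Fc; rewrite /in_chart; case: xgetP => [_ -> [c' [Ac' cx' ->]]|].
  exact: Fc.
by move=> /(_ (F c x)) /=; case; exists c.
Qed.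

(** The transformation rule exhibits a nondegenerate component matrix as a product,
so the Jacobian matrix is invertible without any use of the chain rule. *)
Lemma section_jac_unit g c c' (x : M) : section A g -> A c -> A c' -> dom c x -> dom c' x ->
  g c x \in unitmx -> jac c c' x \in unitmx /\ g c' x \in unitmx.
Proof.
move=> [_ tg] Ac Ac' cx cx'; rewrite (tg c c' x)// !unitmx_mul unitmx_tr.
by move=> /andP[/andP[-> ->]].
Qed.

(** A change of chart conjugates the endomorphism g^-1 h, so that its trace and its
determinant are scalars on the manifold. *)
Lemma section_endo g h c c' (x : M) : section A g -> section A h ->
  A c -> A c' -> dom c x -> dom c' x -> g c x \in unitmx ->
  invmx (g c x) *m h c x =
  invmx (jac c c' x)^T *m (invmx (g c' x) *m h c' x) *m (jac c c' x)^T.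
Proof.
move=> sg sh Ac Ac' cx cx' ug.
have [uJ ug'] := section_jac_unit _ _ _ _ sg Ac Ac' cx cx' ug.
have uJT : (jac c c' x)^T \in unitmx by rewrite unitmx_tr.
apply: (can_inj (mulKmx ug)); rewrite mulKVmx//.
by rewrite (sg.2 c c' x)// (sh.2 c c' x)// !mulmxA !mulmxK.
Qed.

Lemma tr_conj m (P B : 'M[R]_m) : P \in unitmx -> \tr (invmx P *m B *m P) = \tr B.
Proof. by move=> uP; rewrite mxtrace_mulC mulmxA mulmxV// mul1mx. Qed.

Lemma det_conj m (P B : 'M[R]_m) : P \in unitmx -> \det (invmx P *m B *m P) = \det B.
Proof.
move=> uP; rewrite !det_mulmx mulrAC det_inv mulVf ?mul1r//.
by rewrite -unitfE -unitmxE.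
Qed.

Lemma tr_prodE g h k c (x : M) : section A g -> section A h -> section A k ->
  A c -> dom c x -> g c x \in unitmx ->
  tr_prod A g h k x = \tr (invmx (g c x) *m h c x *m invmx (g c x) *m k c x).
Proof.
move=> sg sh sk Ac cx ug; apply: (in_chartE _ c) => // c' Ac' cx'.
rewrite -!(mulmxA _ _ (k _ _)) -!mulmxA !(mulmxA (invmx _)).
have [uJ ug'] := section_jac_unit _ _ _ _ sg Ac Ac' cx cx' ug.
have uJT : (jac c c' x)^T \in unitmx by rewrite unitmx_tr.
rewrite (section_endo _ _ _ _ _ sg sh Ac Ac')// (section_endo _ _ _ _ _ sg sk Ac Ac')//.
set P := _^T; set B := _ *m h c' x; set C := _ *m k c' x.
have -> : invmx P *m B *m P *m (invmx P *m C *m P) = invmx P *m (B *m C) *m P.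
  by rewrite -!mulmxA (mulmxA P) mulmxV// mul1mx.
by rewrite tr_conj.
Qed.

Lemma det_relE g h c (x : M) : section A g -> section A h ->
  A c -> dom c x -> g c x \in unitmx ->
  det_rel A g h x = (\det (g c x))^-1 * \det (h c x).
Proof.
move=> sg sh Ac cx ug; rewrite -det_inv -det_mulmx.
apply: (in_chartE _ c) => // c' Ac' cx'.
have [uJ ug'] := section_jac_unit _ _ _ _ sg Ac Ac' cx cx' ug.
by rewrite (section_endo _ _ _ _ _ sg sh Ac Ac')// det_conj// unitmx_tr.
Qed.

Lemma metric_section g : metric A g -> section A g.
Proof. by case=> -[]. Qed.

Lemma metric_pos g c (x : M) : metric A g -> A c -> dom c x -> pos_def (g c x).
Proof. by move=> [_ pg] Ac cx; exact: pg. Qed.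

Lemma metric_unit g c (x : M) : metric A g -> A c -> dom c x -> g c x \in unitmx.
Proof. by move=> mg Ac cx; exact/pos_def_unit/metric_pos. Qed.

Lemma metric_det_gt0 g c (x : M) : metric A g -> A c -> dom c x -> 0 < \det (g c x).
Proof.
move=> mg Ac cx; apply: pos_def_det_gt0; last exact: metric_pos.
exact: (metric_section _ mg).1.
Qed.

Lemma smooth_section_continuous g c i j (x : M) : smooth_section A g -> A c -> dom c x ->
  {for x, continuous (fun z => g c z i j)}.
Proof.
move=> [_ sg] Ac cx.
have cc : {for x, continuous (coord c)}.
  have := @coord_continuous _ _ _ c.
  by rewrite continuous_open_subspace; [apply; rewrite inE|exact: dom_open].
have [|cg _] := sg c i j Ac [::] (coord c x); first by exists x.
have : component c i j g (coord c z) @[z --> x] --> component c i j g (coord c x).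
  exact: (cvg_comp _ _ cc cg).
rewrite /component coordK//; apply: cvg_trans; apply: near_eq_cvg.
have : nbhs x (dom c) by apply: open_nbhs_nbhs; split => //; exact: dom_open.
by apply: filterS => z cz; rewrite coordK.
Qed.

Lemma smooth_section_measurable g : smooth_section A g -> measurable_section A g.
Proof.
move=> sg c i j Ac; apply: continuous_measurable_lebM; first exact: dom_open.
by move=> x /[!inE] cx; exact: smooth_section_continuous.
Qed.

Lemma measurable_det d (T : measurableType d) (D : set T) m (G : T -> 'M[R]_m) :
  (forall i j, measurable_fun D (fun x => G x i j)) ->
  measurable_fun D (fun x => \det (G x)).
Proof.
move=> mG; apply: measurable_sum => s; apply: measurable_funM => //.
by apply: measurable_prod => i _; exact: mG.
Qed.

Lemma measurable_mulmx_entries d (T : measurableType d) (D : set T) m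
    (G H : T -> 'M[R]_m) :
  (forall i j, measurable_fun D (fun x => G x i j)) ->
  (forall i j, measurable_fun D (fun x => H x i j)) ->
  forall i j, measurable_fun D (fun x => (G x *m H x) i j).
Proof.
move=> mG mH i j; under eq_fun do rewrite mxE.
by apply: measurable_sum => k; exact: measurable_funM.
Qed.

Lemma metric_measurable_inv g c i j : metric A g -> A c ->
  measurable_fun (dom c : set (lebM A)) (fun x => invmx (g c x) i j).
Proof.
move=> mg Ac; apply: continuous_measurable_lebM; first exact: dom_open.
move=> x /[!inE] cx.
have gx : g c z @[z --> x] --> g c x.
  apply/cvg_mxP => k l; exact: (smooth_section_continuous _ _ _ _ _ mg.1 Ac cx).
exact: (proj1 (cvg_mxP _ _) (cvg_invmx _ _ (metric_unit _ _ _ mg Ac cx) gx) i j).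
Qed.

Lemma measurable_det_rel g h : metric A g -> section A h -> measurable_section A h ->
  measurable_fun ([set: M] : set (lebM A)) (det_rel A g h).
Proof.
move=> mg sh mh; apply: measurable_fun_charts => c Ac.
have mc := open_measurable_lebM A _ (dom_open c).
apply: (@eq_measurable_fun _ _ (lebM A) _ _ (fun x => (\det (g c x))^-1 * \det (h c x))).
  move=> x /[!inE] cx; rewrite (det_relE _ _ c)//; first exact: metric_section.
  exact: metric_unit.
apply: measurable_funM; last by apply: measurable_det => i j; exact: mh.
under eq_fun do rewrite -det_inv.
by apply: measurable_det => i j; exact: metric_measurable_inv.
Qed.

Lemma measurable_tr_prod g h : metric A g -> smooth_section A h ->
  measurable_fun ([set: M] : set (lebM A)) (tr_prod A g h h).
Proof.
move=> mg sh; apply: measurable_fun_charts => c Ac.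
have mc := open_measurable_lebM A _ (dom_open c).
apply: (@eq_measurable_fun _ _ (lebM A) _ _
   (fun x => \tr (invmx (g c x) *m h c x *m invmx (g c x) *m h c x))).
  move=> x /[!inE] cx; rewrite (tr_prodE _ _ _ c)//; last exact: metric_unit.
  - exact: metric_section.
  - by case: sh.
  - by case: sh.
have mi := fun i j => metric_measurable_inv g c i j mg Ac.
have mh := fun i j => smooth_section_measurable _ sh c i j Ac.
apply: measurable_sum => i.
by do ! apply: measurable_mulmx_entries.
Qed.

End ChartScalars.

(** * The volume measure of a metric *)

Section IntegralMeasurableSets.

Import HBNNSimple.

(** Volumes are defined as plain set functions; their integrals only see the
measurable sets, where they agree with genuine measures. *)
Lemma eq_integral_measurable_sets d (T : measurableType d) (R : realType)
    (N m : set T -> \bar R) (F : T -> \bar R) :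
  (forall E, measurable E -> N E = m E) ->
  (\int[N]_x F x = \int[m]_x F x)%E.
Proof.
move=> Nm; have sNm (h : {nnsfun T >-> R}) : sintegral N h = sintegral m h.
  by apply: eq_fsbigr => r _; rewrite Nm.
rewrite /integral.
by congr (ereal_sup _ - ereal_sup _)%E; apply/seteqP; split => _ [h hF <-];
  exists h.
Qed.

End IntegralMeasurableSets.

Lemma integral_density d (T : measurableType d) (R : realType)
    (m : {measure set T -> \bar R}) (N : set T -> \bar R) (D : set T) (w : T -> R)
    (F : T -> \bar R) : measurable D -> measurable_fun D w -> (forall x, 0 <= w x) ->
  (forall E, measurable E -> N E = \int[m]_(x in D `&` E) (w x)%:E)%E ->
  measurable_fun setT F -> (forall x, 0 <= F x)%E ->
  (\int[N]_x F x = \int[m]_(x in D) (F x * (w x)%:E))%E.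
Proof.
move=> mD mw w0 NE mF F0.
have mid : measurable_fun D (@id T) by exact: measurable_id.
rewrite -(integral_density_pushforward m D id w mD mid mw w0)//.
by apply: eq_integral_measurable_sets => E mE; rewrite NE.
Qed.

Lemma integral_mrestr d (T : measurableType d) (R : realType)
    (m : {measure set T -> \bar R}) (D E : set T) (mD : measurable D) (F : T -> \bar R) :
  measurable E -> measurable_fun setT F -> (forall x, 0 <= F x)%E ->
  (\int[mrestr m mD]_(x in E) F x = \int[m]_(x in E `&` D) F x)%E.
Proof.
move=> mE mF F0; rewrite [LHS]integral_mkcond (integral_density _ _ _ m _ D (cst 1))//.
- rewrite setIC [RHS]integral_mkcondr; apply: eq_integral => x _.
  by rewrite mule1.
- move=> B mB; have := integral_cst m (measurableI _ _ mD mB) 1%E.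
  by rewrite mul1e (setIC D B) => eB; exact: esym eB.
- by apply/(measurable_restrictT F mE); exact: measurable_funTS mF.
- by move=> x; exact: erestrict_ge0.
Qed.

Lemma measurable_fun_sqrt d (T : measurableType d) (R : realType) (D : set T)
    (f : T -> R) : measurable_fun D f -> measurable_fun D (fun x => Num.sqrt (f x)).
Proof.
move=> mf; apply: (measurableT_comp _ mf).
by apply: continuous_measurable_fun; exact: sqrt_continuous.
Qed.

Section Volume.
Context {R : realType} {n : nat} {M : ptopologicalType} (A : set (chart R n M)).
Hypothesis M_hausdorff : hausdorff_space M.
Implicit Types (c : chart R n M) (g h : @field R n M).

Lemma compact_measurable_lebM (K : set M) : compact K -> measurable (K : set (lebM A)).
Proof.
move=> /(compact_closed M_hausdorff) cK; rewrite -[K]setCK; apply: measurableC.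
by apply: open_measurable_lebM; exact: closed_openC.
Qed.

Lemma within_coord_continuous c (K : set M) : K `<=` dom c ->
  {within K, continuous (coord c)}.
Proof. by move=> Kc; apply: continuous_subspaceW Kc _; exact: coord_continuous. Qed.

Definition cover_piece (cK : chart R n M * set M) :=
  [/\ A cK.1, compact cK.2 & cK.2 `<=` dom cK.1].

(** Induction on the cover.  On the first piece, the density of [h] in the chart is
that of [g] times sqrt (det (g^-1 h)); the other pieces give the measure of the
induction hypothesis restricted to the complement of the first.  Finiteness comes
from compactness: the density is bounded and the image in the chart has finite
Lebesgue measure. *)
Lemma volume_rec_measure g s : metric A g -> List.Forall cover_piece s ->
  exists m : {measure set (lebM A) -> \bar R},
  [/\ forall E, measurable (E : set (lebM A)) -> m E = volume_rec g s E,
      (m setT < +oo)%E &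
      forall h, section A h -> measurable_section A h ->
        forall E, measurable (E : set (lebM A)) ->
        (volume_rec h s E = \int[m]_(x in E) (Num.sqrt (det_rel A g h x))%:E)%E].
Proof.
move=> mg; elim: s => [_|[c K] s IH].
  exists mzero; split => [//||h sh mh E mE].
    by rewrite /= /mzero ltry.
  by rewrite integral_measure_zero.
move=> Hs; have [[/= Ac cK Kc] {}/IH[m' [m'E m'fin m'h]]] :
    cover_piece (c, K) /\ List.Forall cover_piece s by inversion Hs.
have mK := compact_measurable_lebM _ cK.
have [mS mphi] := measurable_point A c K Ac Kc mK.
have mc := open_measurable_lebM A _ (dom_open c).
have SE E : coord c @` K `&` point c @^-1` E = coord c @` (E `&` K).
  apply/seteqP; split=> [_ [[x Kx <-]]|_ [x [Ex Kx] <-]] /=.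
    by rewrite coordK; [exists x|exact: Kc].
  by rewrite coordK; [split => //; exists x|exact: Kc].
pose w y := Num.sqrt (\det (g c (point c y))).
have w0 y : 0 <= w y by exact: sqrtr_ge0.
have mdet k : measurable_section A k ->
    measurable_fun (dom c : set (lebM A)) (fun x => Num.sqrt (\det (k c x))).
  move=> mk; apply: measurable_fun_sqrt.
  by apply: measurable_det => i j; exact: mk.
have mw : measurable_fun (coord c @` K : set (lebesgueR R n)) w.
  apply: (measurable_comp mc _ (mdet g (smooth_section_measurable _ _ mg.1)) mphi).
  by move=> _ [_ [x Kx <-] <-]; rewrite coordK; exact: Kc.
pose nu := density_pushforward (@lebesgue R n) _ _ _ mS mphi mw w0.
exists (measure_add nu (mrestr m' (measurableC mK))); split.
- move=> E mE; transitivity (nu E + m' (E `\` K))%E.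
    by rewrite setDE; exact: measure_addE.
  rewrite /= -m'E//; last exact: measurableD.
  by rewrite /nu /density_pushforward SE.
- apply: (@le_lt_trans _ _ (nu setT + m' (setT `&` ~` K))%E).
    by rewrite le_eqVlt; apply/orP; left; apply/eqP; exact: measure_addE.
  apply: lte_add_pinfty; last first.
    by apply: le_lt_trans m'fin; apply: le_measure; rewrite ?inE//= setTI; exact: measurableC.
  rewrite /nu /= /density_pushforward preimage_setT setIT.
  have [B [B0 wB]] : exists B : R, 0 <= B /\ forall y, (coord c @` K) y -> w y <= B.
    have : compact ((fun x => Num.sqrt (\det (g c x))) @` K).
      apply: continuous_compact => //; apply/subspace_continuousP => x Kx.
      apply: cvg_within_filter; apply: cvg_sqrt; apply: cvg_det.
      apply/cvg_mxP => i j; apply: (smooth_section_continuous _ _ _ _ _ _ mg.1) => //.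
      exact: Kc.
    move=> /compact_bounded[b [_ bK]]; exists (`|b| + 1); split; first by rewrite addr_ge0.
    move=> _ [x Kx <-]; rewrite /w coordK; last exact: Kc.
    apply: le_trans (ler_norm _) _; apply: bK; last by exists x.
    by rewrite ltr_pwDr// ler_norm.
  apply: (@le_lt_trans _ _ (\int[@lebesgue R n]_(y in coord c @` K) B%:E)%E).
    apply: ge0_le_integral => //.
    + by move=> y Ky; rewrite lee_fin // wB.
    + exact/measurable_EFinP.
  have -> : (\int[@lebesgue R n]_(y in coord c @` K) B%:E =
      B%:E * @lebesgue R n (coord c @` K))%E by exact: (integral_cst _ mS).
  apply: lte_mul_pinfty => //; apply: lebesgue_bounded.
  apply: compact_bounded; apply: continuous_compact => //.
  exact: within_coord_continuous.
- move=> h sh mh E mE.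
  set rho := fun x => (Num.sqrt (det_rel A g h x))%:E.
  have rho0 x : (0 <= rho x)%E by rewrite lee_fin sqrtr_ge0.
  have mrho : measurable_fun ([set: M] : set (lebM A)) rho.
    apply/measurable_EFinP; apply: measurable_fun_sqrt.
    exact: measurable_det_rel.
  rewrite ge0_integral_measure_add//; last exact: measurable_funTS mrho.
  rewrite /=; congr (_ + _)%E; last first.
    by rewrite integral_mrestr// -setDE m'h//; exact: measurableD.
  rewrite [RHS]integral_mkcond integral_density_pushforward; first last.
  + by move=> x; exact: erestrict_ge0.
  + exact: (proj1 (measurable_restrictT (rho : lebM A -> \bar R) mE) (measurable_funTS mrho)).
  rewrite -SE integral_mkcondr; apply: eq_integral => y /[!inE] -[x Kx <-].
  rewrite !patchE /w /rho /= coordK; last exact: Kc.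
  have -> : (coord c x \in point c @^-1` E) = (x \in E).
    by apply/idP/idP; rewrite !inE /= coordK//; exact: Kc.
  case: ifPn; rewrite ?mul0e// => _.
  rewrite -EFinM (det_relE _ _ _ c)//; first last.
  + exact: (metric_unit _ _ _ _ mg Ac (Kc _ Kx)).
  + exact: Kc.
  + exact: metric_section.
  have dg : 0 < \det (g c x) by apply: (metric_det_gt0 A) => //; exact: Kc.
  congr (_%:E); rewrite mulrC -sqrtrM ?(ltW dg)// mulrA divff ?gt_eqF//.
  by rewrite mul1r.
Qed.

Lemma the_cover_good : List.Forall cover_piece (the_cover A).
Proof.
rewrite /the_cover; case: pselect => [e|_]; last exact: List.Forall_nil.
by case: (projT2 (cid e)).
Qed.

Lemma volume_measure g : metric A g ->
  exists m : {finite_measure set (lebM A) -> \bar R},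
  (forall E, measurable (E : set (lebM A)) -> m E = volume g E) /\
  forall h, section A h -> measurable_section A h ->
    forall E, measurable (E : set (lebM A)) ->
    (@volume _ _ _ A h E = \int[m]_(x in E) (Num.sqrt (det_rel A g h x))%:E)%E.
Proof.
move=> mg; have [m [mE mfin mh]] := volume_rec_measure _ _ mg the_cover_good.
pose mf : {finite_measure set (lebM A) -> \bar R} := mfrestr measurableT mfin.
have mfm E : mf E = m E by rewrite /mf /= /mfrestr /mrestr setIT.
exists mf; split => [E mE'|h sh mh' E mE']; first by rewrite mfm mE.
by rewrite [LHS]mh//; apply: eq_measure_integral => F _ _; exact: (esym (mfm F)).
Qed.

End Volume.

(** * Square-integrability of the total length *)

Section L2Analysis.
Context {d : measure_display} {T : measurableType d} {R : realType}
  (m : {finite_measure set T -> \bar R}).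
Notation leb := (@lebesgue_measure R).

(** Projection onto the interval: it extends a function defined on [a, b] to all times
without losing continuity. *)
Definition clamp (a b t : R) := Num.max a (Num.min b t).

Lemma clamp_itv a b t : a <= b -> a <= clamp a b t <= b.
Proof.
by move=> ab; rewrite /clamp; rewrite le_max lexx /= ge_max ab ge_min lexx.
Qed.

Lemma clampK a b t : a <= t <= b -> clamp a b t = t.
Proof.
by move=> /andP[at_ tb]; rewrite /clamp (min_idPr tb) (max_idPr at_).
Qed.

Lemma continuous_clamp a b : continuous (clamp a b).
Proof.
move=> t; apply: (@continuous_max _ _ (cst a) (Num.min b)); first exact: cst_continuous.
apply: (@continuous_min _ _ (cst b) id); first exact: cst_continuous.
exact: cvg_id.
Qed.

(** A function continuous in time and measurable in space is the pointwise limit of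
its values at the times rounded down to multiples of 1 / (k + 1), which are
measurable as countable gluings over the rounded times. *)
Lemma measurable_caratheodory_function (a b : R) (f : R -> T -> R) : a <= b ->
  (forall t, a <= t <= b -> measurable_fun setT (f t)) ->
  (forall x, {within `[a, b], continuous (f^~ x)}) ->
  measurable_fun setT (fun z : measurableTypeR R * T => f (clamp a b z.1) z.2).
Proof.
move=> ab mf cf.
(* t rounded down to a multiple of 1 / (k + 1) *)
pose st (k : nat) (t : R) : R := (Num.floor (t * k.+1%:R))%:~R / k.+1%:R.
apply: (measurable_fun_cvg
  (h := fun k (z : measurableTypeR R * T) => f (clamp a b (st k z.1)) z.2)).
  move=> k _ B mB; rewrite setTI.
  pose I (z : int) : set (measurableTypeR R) := `[z%:~R / k.+1%:R, (z + 1)%:~R / k.+1%:R[%classic.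
  rewrite [X in measurable X](_ : _ = \bigcup_(z : int)
     (I z `*` (f (clamp a b (z%:~R / k.+1%:R)) @^-1` B))).
    apply: countable_bigcupT_measurable => [|z]; first exact: countableP.
    apply: measurableX; first exact: measurable_itv.
    by rewrite -[X in measurable X]setTI; apply: mf => //; exact: clamp_itv.
  have Ik (t : R) z : I z t <-> Num.floor (t * k.+1%:R) = z.
    rewrite /I /= in_itv /= ler_pdivrMr ?ltr_pdivlMr//.
    by rewrite -floor_eq; split => /eqP.
  apply/seteqP; split => [[t x] /= Bt|[t x] [z _ [/= /Ik tz Bz]]].
    by exists (Num.floor (t * k.+1%:R)) => //; split => //; exact/Ik.
  by rewrite /= /st tz.
move=> [t x] _ /=.
have stt : st k t @[k --> \oo] --> t.
  apply: (@squeeze_cvgr _ _ _ _ (fun k => t - k.+1%:R^-1) (fun=> t)).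
  - apply: nearW => k; have k0 : 0 < k.+1%:R :> R by [].
    have /andP[f1 f2] := floor_itv (t * k.+1%:R).
    rewrite /st ler_pdivrMr// f1 andbT ler_pdivlMr// mulrBl mulVf// lerBlDr.
    by rewrite -[1]/(1%:~R) -intrD ltW.
  - rewrite -[X in _ --> X]subr0; apply: cvgB; first exact: cvg_cst.
    exact: cvg_harmonic.
  - exact: cvg_cst.
have ct : clamp a b (st k t) @[k --> \oo] --> clamp a b t.
  by apply: (cvg_comp _ _ stt); exact: continuous_clamp.
have /subspace_continuousP/(_ (clamp a b t)) := cf x.
rewrite /= in_itv /= => /(_ (clamp_itv _ _ t ab)) cfx.
apply: (cvg_comp _ _ _ cfx).
move=> U UV; suff : \forall k \near \oo, U (clamp a b (st k t)) by [].
have : \forall k \near \oo, `[a, b]%classic (clamp a b (st k t)) ->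
  U (clamp a b (st k t)) := ct _ UV.
by apply: filterS => k /=; rewrite in_itv /=; apply; exact: clamp_itv.
Qed.

Lemma integral_cauchy_schwarz (f g : T -> R) :
  measurable_fun setT f -> measurable_fun setT g ->
  (forall x, 0 <= f x) -> (forall x, 0 <= g x) ->
  (\int[m]_x (f x * g x)%:E <=
    sqrte (\int[m]_x (f x ^+ 2)%:E) * sqrte (\int[m]_x (g x ^+ 2)%:E))%E.
Proof.
move=> mf mg f0 g0.
have N2 (h : T -> R) : (forall x, 0 <= h x) ->
    'N[m]_2%:E[EFin \o h]%E = sqrte (\int[m]_x (h x ^+ 2)%:E)%E.
  move=> h0; rewrite unlock /= poweR12_sqrt; last first.
    by apply: integral_ge0 => x _; rewrite lee_fin powR_ge0.
  congr (sqrte _); apply: eq_integral => x _.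
  by rewrite /= (ger0_norm (h0 x)) powR_mulrn.
have := @hoelder _ _ _ m f g 2 2 mf mg.
rewrite !N2//; have -> : 'N[m]_1[EFin \o (f \* g)%R]%E = (\int[m]_x (f x * g x)%:E)%E.
  rewrite unlock /= invr1 poweRe1; last first.
    by apply: integral_ge0 => x _; rewrite lee_fin powR_ge0.
  apply: eq_integral => x _ /=.
  by rewrite powRr1// ger0_norm// mulr_ge0.
by apply => //; rewrite -div1r -splitr.
Qed.

Lemma measurable_sqrte_comp d' (S : measurableType d') (G : S -> \bar R) :
  (forall x, 0 <= G x)%E -> measurable_fun setT G ->
  measurable_fun setT (fun x => sqrte (G x)).
Proof.
move=> G0 mG; under eq_fun do rewrite -poweR12_sqrt//.
exact: (measurableT_comp (measurable_poweR _)).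
Qed.

(** Tonelli's theorem exchanges time and space; at each time, Cauchy-Schwarz. *)
Lemma weighted_length_le (a b : R) (f : R -> T -> R) (q : T -> R) : a <= b ->
  (forall t x, a <= t <= b -> 0 <= f t x) ->
  (forall t, a <= t <= b -> measurable_fun setT (f t)) ->
  (forall x, {within `[a, b], continuous (f^~ x)}) ->
  measurable_fun setT q -> (forall x, 0 <= q x) ->
  (\int[m]_x ((q x)%:E * \int[leb]_(t in `[a, b]) (f t x)%:E) <=
   sqrte (\int[m]_x (q x ^+ 2)%:E) *
   \int[leb]_(t in `[a, b]) sqrte (\int[m]_x (f t x ^+ 2)%:E))%E /\
  measurable_fun setT (fun x => \int[leb]_(t in `[a, b]) (f t x)%:E)%E.
Proof.
move=> ab f0 mf cf mq q0.
have mF := measurable_caratheodory_function _ _ _ ab mf cf.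
pose F (z : measurableTypeR R * T) : R := f (clamp a b z.1) z.2.
have F0 z : 0 <= F z by apply: f0; exact: clamp_itv.
have FE t x : (`[a, b]%classic : set R) t -> F (t, x) = f t x.
  by rewrite /= in_itv /= => tab; rewrite /F /= clampK.
have mD : measurable (`[a, b]%classic : set (measurableTypeR R)) by exact: measurable_itv.
(* Both integrals are taken over all times, with the indicator of [a, b]. *)
pose ind (t : measurableTypeR R) : R := \1_(`[a, b]%classic : set (measurableTypeR R)) t.
have ind1 t : (`[a, b]%classic : set R) t -> ind t = 1.
  by move=> tab; rewrite /ind indicE mem_set.
have ind0 t : ~ (`[a, b]%classic : set R) t -> ind t = 0.
  by move=> tab; rewrite /ind indicE memNset.
have ind_ge0 t : 0 <= ind t by [].
pose G (z : measurableTypeR R * T) : \bar R := (F z * ind z.1)%:E.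
have mind : measurable_fun setT (fun z : measurableTypeR R * T => ind z.1).
  by apply: measurableT_comp => //; exact: measurable_indic.
have mG : measurable_fun setT G.
  by apply/measurable_EFinP; exact: measurable_funM.
have G0 z : (0 <= G z)%E by rewrite lee_fin mulr_ge0.
have GE (x : T) : (\int[leb]_t G (t, x) = \int[leb]_(t in `[a, b]) (f t x)%:E)%E.
  rewrite [RHS]integral_mkcond; apply: eq_integral => t _.
  rewrite patchE /G /=; case: ifPn => [|]; rewrite ?notin_setE ?inE => tab.
    by rewrite ind1// mulr1 FE.
  by rewrite ind0// mulr0.
split; last first.
  under eq_fun do rewrite -GE.
  exact: (measurable_fun_fubini_tonelli_G (m1 := leb) G).
pose H (z : measurableTypeR R * T) : \bar R := ((q z.2)%:E * G z)%E.
have mq2 : measurable_fun setT (fun z : measurableTypeR R * T => q z.2).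
  exact: measurableT_comp.
have mH : measurable_fun setT H.
  by apply: emeasurable_funM => //; exact/measurable_EFinP.
have H0 z : (0 <= H z)%E by rewrite mule_ge0// lee_fin.
have mFt (t : measurableTypeR R) : measurable_fun setT (fun x => F (t, x)).
  exact: (mf (clamp a b t) (clamp_itv _ _ t ab)).
rewrite (_ : (\int[m]_x _ = \int[m]_x \int[leb]_t H (t, x))%E); last first.
  apply: eq_integral => x _; rewrite -GE /H /= ge0_integralZl//.
  - exact: (measurableT_comp mG).
  - by rewrite lee_fin.
rewrite -(fubini_tonelli (m1 := leb) (m2 := m) H)//.
pose K (t : measurableTypeR R) := (sqrte (\int[m]_x (F (t, x) ^+ 2)%:E))%E.
have mK : measurable_fun setT K.
  apply: measurable_sqrte_comp.
    by move=> t; apply: integral_ge0 => x _; rewrite lee_fin sqr_ge0.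
  apply: (measurable_fun_fubini_tonelli_F (m2 := m) (fun z => (F z ^+ 2)%:E)).
    by apply/measurable_EFinP; exact: measurable_funX.
  by move=> z; rewrite lee_fin sqr_ge0.
rewrite (_ : (\int[leb]_(t in _) _ = \int[leb]_(t in `[a, b]) K t)%E); last first.
  apply: eq_integral => t /[!inE] tab; congr (sqrte _).
  by apply: eq_integral => x _; rewrite FE.
have mKab : measurable_fun (`[a, b]%classic : set (measurableTypeR R)) K.
  exact: measurable_funTS.
rewrite -(@ge0_integralZl _ _ _ leb _ mD K mKab)//; last 2 first.
- by move=> t _; exact: sqrte_ge0.
- exact: sqrte_ge0.
rewrite [leRHS]integral_mkcond; apply: ge0_le_integral => //.
- by move=> t _; apply: integral_ge0 => x _.
- exact: (measurable_fun_fubini_tonelli_F (m2 := m) H).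
- apply/(measurable_restrictT _ mD); apply: measurable_funTS.
  exact: measurable_funeM.
move=> t _; rewrite patchE; case: ifPn => [tab|tab]; last first.
  rewrite integral0_eq// => x _.
  by rewrite /H /G /= ind0 ?mulr0 ?mule0//; move: tab; rewrite notin_setE.
apply: le_trans (integral_cauchy_schwarz _ _ mq (mFt t) q0 (fun x => F0 (t, x))).
apply: ge0_le_integral => //.
- exact: (measurableT_comp mH).
- by apply/measurable_EFinP; exact: measurable_funM.
- by move=> x _; rewrite /H /G /= ind1 ?mulr1 ?EFinM//; move: tab; rewrite inE.
Qed.

(** Apply the hypothesis to q = min (Th, N) with Th the sum: the integral of q^2 is at
most that of q * Th, hence at most its own square root times the sum of the L k.
It is finite because q is bounded and the measure is finite, so it is at most the
square of that sum, uniformly in N. *)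
Lemma sum_square_integrable (th : nat -> T -> \bar R) (L : nat -> \bar R) :
  (forall k, measurable_fun setT (th k)) -> (forall k x, 0 <= th k x)%E ->
  (forall k, 0 <= L k)%E -> (\sum_(k <oo) L k < +oo)%E ->
  (forall k (q : T -> R), measurable_fun setT q -> (forall x, 0 <= q x) ->
    (\int[m]_x ((q x)%:E * th k x) <= sqrte (\int[m]_x (q x ^+ 2)%:E) * L k)%E) ->
  (\int[m]_x ((\sum_(k <oo) th k x) * (\sum_(k <oo) th k x)) < +oo)%E.
Proof.
move=> mth th0 L0 Lfin thL.
pose Th x := (\sum_(k <oo) th k x)%E.
have Th0 x : (0 <= Th x)%E by apply: nneseries_ge0 => k _ _.
have mTh : measurable_fun setT Th.
  by apply: (ge0_emeasurable_sum (P := xpredT)) => [k x _ _|k _]; [exact: th0|exact: mth].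
pose trunc (N : nat) x : \bar R := mine (Th x) N%:R%:E.
have trunc0 N x : (0 <= trunc N x)%E by rewrite /trunc le_min Th0 lee_fin ler0n.
have mtrunc N : measurable_fun setT (trunc N) by exact: measurable_mine.
pose q N x := fine (trunc N x).
have qE N x : (q N x)%:E = trunc N x.
  rewrite fineK// ge0_fin_numE//; apply: (@le_lt_trans _ _ N%:R%:E); last exact: ltry.
  by rewrite ge_min lexx orbT.
have mq N : measurable_fun setT (q N).
  apply/measurable_EFinP; rewrite (_ : _ \o _ = trunc N)//.
  by apply/funext => x; exact: qE.
have q0 N x : 0 <= q N x by rewrite fine_ge0.
pose Lt := (\sum_(k <oo) L k)%E.
have Lt0 : (0 <= Lt)%E by apply: nneseries_ge0 => k _ _.
pose I N := (\int[m]_x (q N x ^+ 2)%:E)%E.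
have I0 N : (0 <= I N)%E by apply: integral_ge0 => x _; rewrite lee_fin sqr_ge0.
have mq2 N : measurable_fun setT (fun x => (q N x ^+ 2)%:E).
  by apply/measurable_EFinP; exact: measurable_funX.
have Ifin N : (I N < +oo)%E.
  apply: (@le_lt_trans _ _ (\int[m]_x (cst (N%:R ^+ 2)%:E x)))%E.
    apply: ge0_le_integral => //.
    - by move=> x _; rewrite lee_fin sqr_ge0.
    - move=> x _; rewrite lee_fin ler_sqr ?nnegrE//.
      by rewrite -lee_fin qE ge_min lexx orbT.
  rewrite integral_cst// lte_mul_pinfty// ?lee_fin ?sqr_ge0//.
  by rewrite -ge0_fin_numE// fin_num_measure.
have sfin N : sqrte (I N) \is a fin_num by rewrite sqrte_fin_num// ge0_fin_numE.
have IL N : (I N <= sqrte (I N) * Lt)%E.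
  apply: (@le_trans _ _ (\int[m]_x ((q N x)%:E * Th x)))%E.
    apply: ge0_le_integral => //.
    - by move=> x _; rewrite lee_fin sqr_ge0.
    - by apply: emeasurable_funM => //; exact/measurable_EFinP.
    - by move=> x _; rewrite expr2 EFinM lee_wpmul2l ?lee_fin// qE ge_min lexx.
  have -> : (\int[m]_x ((q N x)%:E * Th x) =
      \sum_(k <oo) \int[m]_x ((q N x)%:E * th k x))%E.
    rewrite -integral_nneseries//; last 2 first.
    - by move=> k; apply: emeasurable_funM => //; exact/measurable_EFinP.
    - by move=> k x _; rewrite mule_ge0// lee_fin.
    by apply: eq_integral => x _; rewrite nneseriesZl.
  rewrite -[X in (_ <= X * _)%E](fineK (sfin N)) -nneseriesZl; last by [].
  rewrite fineK//.
  apply: lee_nneseries => k _; last exact: thL.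
  by move=> _; apply: integral_ge0 => x _; rewrite mule_ge0// lee_fin.
have ILt N : (I N <= Lt * Lt)%E.
  have [->|I1] := eqVneq (I N) 0%E; first by rewrite mule_ge0.
  have sI : (0 < sqrte (I N))%E.
    rewrite lt_neqAle sqrte_ge0 andbT eq_sym; apply: contra I1 => /eqP s0.
    by rewrite -(sqr_sqrte (I0 N)) s0 expe2 mule0.
  have h : (sqrte (I N) <= Lt)%E.
    rewrite -(@lee_pmul2l _ (sqrte (I N)))//.
    by rewrite -expe2 sqr_sqrte.
  rewrite -[X in (X <= _)%E]sqr_sqrte// expe2.
  by apply: lee_pmul => //; exact: sqrte_ge0.
have cvgq x : (q N x ^+ 2)%:E @[N --> \oo] --> (Th x * Th x)%E.
  have cq : (q N x)%:E @[N --> \oo] --> Th x.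
    under eq_fun do rewrite qE /trunc.
    have := Th0 x; case: (Th x) => [r _| _|//].
      apply: cvg_near_cst; near=> N; rewrite min_l// lee_fin.
      by near: N; exact: nbhs_infty_ger.
    under eq_fun do rewrite min_r ?leey//.
    exact/cvgenyP.
  under eq_fun do rewrite expr2 EFinM.
  apply: cvgeM => //; have := Th0 x; case: (Th x) => //= r r0.
rewrite -/(Th _).
have -> : (\int[m]_x (Th x * Th x) = limn I)%E.
  rewrite -monotone_convergence//.
  - by apply: eq_integral => x _; apply/esym/cvg_lim => //; exact: cvgq.
  - by move=> N x _; rewrite lee_fin sqr_ge0.
  - move=> x _ N N' NN'; rewrite lee_fin ler_sqr ?nnegrE//.
    rewrite -lee_fin !qE le_min !ge_min lexx /= lee_fin ler_nat NN' orbT//.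
apply: (@le_lt_trans _ _ (Lt * Lt)%E); last first.
  by rewrite lte_mul_pinfty// ge0_fin_numE.
apply: lime_le; last by apply: nearW.
apply: ereal_nondecreasing_is_cvgn => N N' NN'; apply: ge0_le_integral => //.
- by move=> x _; rewrite lee_fin sqr_ge0.
- move=> x _; rewrite lee_fin ler_sqr ?nnegrE//.
  rewrite -lee_fin !qE le_min !ge_min lexx /= lee_fin ler_nat NN' orbT//.
Unshelve. all: by end_near. Qed.

End L2Analysis.

(** * Pointwise length of paths of metrics *)

Section DifferenceQuotient.
Context {R : realType}.

Lemma is_derive_quotient (f : R -> R) (t l : R) :
  (u - t)^-1 * (f u - f t) @[u --> t^'] --> l -> is_derive t 1 f l.
Proof.
move=> fl.
have H : h^-1 *: (f (h *: 1 + t) - f t) @[h --> 0^'] --> l.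
  apply/cvgrPdist_lt => e e0.
  have /cvgrPdist_lt/(_ e e0) := fl.
  move=> /nbhs_ballP[d /= d0 dP]; apply/nbhs_ballP; exists d => //= h hd h0.
  have := dP (h + t); rewrite /= addrK [h *: 1]mulr1; apply; last first.
    by rewrite -subr_eq0 addrK.
  by move: hd; rewrite /ball /= sub0r normrN opprD addrCA subrr addr0 normrN.
by apply: DeriveDef; [apply/cvg_ex; exists l|exact: cvg_lim].
Qed.

(** A function with a difference quotient converging inside D is continuous inside D,
also at the end points of an interval. *)
Lemma quotient_continuous (f : R -> R) (D : set R) (t l : R) :
  (u - t)^-1 * (f u - f t) @[u --> within D t^'] --> l ->
  f u @[u --> within D (nbhs t)] --> f t.
Proof.
move=> fl; apply/cvgrPdist_lt => e e0.
have c0 : 0 < `|l| + 1 by rewrite ltr_pwDr.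
have /cvgrPdist_lt/(_ 1 ltr01) := fl.
move=> /nbhs_ballP[d /= d0 dP].
apply/nbhs_ballP; exists (Num.min d (e / (`|l| + 1))) => /=.
  by rewrite lt_min d0 divr_gt0.
move=> u; rewrite /ball /= lt_min => /andP[ud ue] Du.
have [->|ut] := eqVneq u t; first by rewrite subrr normr0.
have := dP u ud ut Du.
move=> h; have ut0 : 0 < `|u - t| by rewrite normr_gt0 subr_eq0.
have {}h : `|(u - t)^-1 * (f u - f t)| < `|l| + 1.
  rewrite -[X in `|X|](subrK l); apply: le_lt_trans (ler_normD _ _) _.
  by rewrite addrC ltrD2l distrC.
rewrite normrM normfV ltr_pdivrMl// in h.
rewrite distrC (lt_le_trans h)// -ler_pdivlMr// distrC ltW//.
Qed.

End DifferenceQuotient.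

Section MetricPath.
Context {R : realType} {n : nat} {M : ptopologicalType} (A : set (chart R n M)).
Hypothesis A_cover : charts_cover A.
Notation leb := (@lebesgue_measure R).
Implicit Types (c : chart R n M) (g h : @field R n M) (a b t : R).

(** Points are compact and the empty list of derivatives is allowed, so Frechet
convergence contains the pointwise convergence of the components. *)
Lemma frechet_cvg_point (T : Type) (F : set_system T) {FF : Filter F}
    (hs : T -> field) h c (x : M) i j :
  frechet_cvg A F hs h -> A c -> dom c x ->
  hs u c x i j @[u --> F] --> h c x i j.
Proof.
move=> Fh Ac cx; apply/cvgrPdist_lt => e e0.
have cK : compact [set coord c x] by exact: compact_set1.
have K_codom : [set coord c x] `<=` coord c @` dom c by move=> _ ->; exists x.
have := Fh c _ [::] i j e Ac cK K_codom e0; apply: filterS => u /(_ _ erefl).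
by rewrite /= /component coordK// distrC.
Qed.

Lemma C1_on_posdef_path a b (gam vel : R -> field) c (x : M) :
  a < b -> C1_on A a b gam vel -> A c -> dom c x ->
  posdef_path a b (fun t => gam t c x) (fun t => vel t c x).
Proof.
move=> ab P Ac cx.
have quot t i j : a <= t <= b ->
    (u - t)^-1 * (gam u c x i j - gam t c x i j) @[u --> within `[a, b] t^']
      --> vel t c x i j.
  move=> /P[_ _ D _]; have FF : Filter (within `[a, b] t^') by exact: within_filter.
  have := @frechet_cvg_point _ _ FF _ _ _ _ i j D Ac cx.
  by move=> DG; apply: (cvg_trans _ DG); apply: near_eq_cvg; apply: nearW => u; rewrite !mxE.
split => // [t /P[mg _ _ _]|t /P[mg _ _ _]|t /P[_ sv _ _]||| t tab i j].
- exact: (metric_section _ _ mg).1.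
- exact: metric_pos mg Ac cx.
- exact: sv.1.1.
- apply/subspace_continuousP => t; rewrite /= in_itv /= => tab.
  apply/cvg_mxP => i j.
  exact: (quotient_continuous (fun u => gam u c x i j) _ _ _ (quot t i j tab)).
- apply/subspace_continuousP => t; rewrite /= in_itv /= => tab.
  apply/cvg_mxP => i j; have [_ _ _ V] := P t tab.
  exact: (frechet_cvg_point _ _ _ _ _ _ i j V Ac cx).
- have [at_ tb] := andP tab.
  apply: is_derive_quotient.
  have tab' : a <= t <= b by rewrite !ltW.
  move=> U /(quot t i j tab'); rewrite /= !nbhs_simpl /= => H.
  have N : nbhs t `]a, b[%classic.
    by apply: open_nbhs_nbhs; split; [exact: interval_open|rewrite /= in_itv].
  by apply: filterS2 N H => u uab h ut; apply: h => //; exact: subset_itv_oo_cc uab.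
Qed.

(** The pointwise speed: its square, integrated against the volume of g, is the squared
L2 norm of the velocity. *)
Definition speed g (gam vel : R -> @field R n M) t (x : M) : R :=
  Num.sqrt (tr_prod A (gam t) (vel t) (vel t) x * Num.sqrt (det_rel A g (gam t) x)).

Fixpoint point_length g (gam : R -> @field R n M) a (p : seq (R * (R -> @field R n M)))
    (x : M) : \bar R :=
  if p is (b, vel) :: p' then
    (\int[leb]_(t in `[a, b]) (speed g gam vel t x)%:E + point_length g gam b p' x)%E
  else 0%E.

Lemma speed_chart g a b gam vel t c (x : M) : metric A g -> C1_on A a b gam vel ->
  a <= t <= b -> A c -> dom c x ->
  speed g gam vel t x = mx_speed (\det (g c x))^-1 (gam t c x) (vel t c x).
Proof.
move=> mg P tab Ac cx; have [mt sv _ _] := P t tab.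
rewrite /speed /mx_speed (tr_prodE A _ _ _ c)//; last first.
- exact: metric_unit mt Ac cx.
- exact: sv.1.
- exact: sv.1.
- exact: metric_section.
rewrite (det_relE A _ _ c)//; [exact: metric_section..|].
exact: metric_unit mg Ac cx.
Qed.

Lemma tr_prod_ge0 g h (x : M) : metric A g -> section A h -> 0 <= tr_prod A g h h x.
Proof.
move=> mg sh; have [c Ac cx] := A_cover x.
rewrite (tr_prodE A _ _ _ c)//; [|exact: metric_section|exact: metric_unit mg Ac cx].
apply: trace_form_ge0; [|exact: metric_pos mg Ac cx|exact: sh.1].
exact: (metric_section _ _ mg).1.
Qed.

Lemma speed_ge0 g gam vel t (x : M) : 0 <= speed g gam vel t x.
Proof. exact: sqrtr_ge0. Qed.

Lemma measurable_speed g a b gam vel t : metric A g -> C1_on A a b gam vel ->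
  a <= t <= b -> measurable_fun ([set: M] : set (lebM A)) (speed g gam vel t).
Proof.
move=> mg P tab; have [mt sv _ _] := P t tab.
apply: measurable_fun_sqrt; apply: measurable_funM.
  exact: measurable_tr_prod.
apply: measurable_fun_sqrt; apply: measurable_det_rel => //.
  exact: metric_section.
exact: (smooth_section_measurable _ _ mt.1).
Qed.

Lemma continuous_speed g a b gam vel (x : M) : metric A g -> a < b ->
  C1_on A a b gam vel -> {within `[a, b], continuous (fun t => speed g gam vel t x)}.
Proof.
move=> mg ab P; have [c Ac cx] := A_cover x.
have Q := C1_on_posdef_path _ _ _ _ _ _ ab P Ac cx.
have := continuous_mx_speed (\det (g c x))^-1 _ _ _ _ Q.
move=> /subspace_continuousP cm; apply/subspace_continuousP => t tab.
have tab' : a <= t <= b by move: tab; rewrite /= in_itv.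
rewrite /from_subspace (speed_chart _ a b _ _ _ c)//.
apply: cvg_trans (cm t tab); apply: near_eq_cvg.
apply: filterS (withinT _ _) => u uab.
by rewrite (speed_chart _ a b _ _ _ c)//; move: uab; rewrite /= in_itv.
Qed.

Variables (g : @field R n M) (mg : metric A g).
Variable (m : {finite_measure set (lebM A) -> \bar R}).
Hypothesis mh : forall h, section A h -> measurable_section A h ->
  forall E, measurable (E : set (lebM A)) ->
  (@volume _ _ _ A h E = \int[m]_(x in E) (Num.sqrt (det_rel A g h x))%:E)%E.

Lemma L2_speed a b gam vel t : C1_on A a b gam vel -> a <= t <= b ->
  L2 A (gam t) (vel t) (vel t) = (\int[m]_x (speed g gam vel t x ^+ 2)%:E)%E.
Proof.
move=> P tab; have [mt sv _ _] := P t tab.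
have mtr := measurable_tr_prod A _ _ mt sv.
have mdr := measurable_det_rel A g (gam t) mg (metric_section _ _ mt)
  (smooth_section_measurable _ _ mt.1).
have tr0 x : 0 <= tr_prod A (gam t) (vel t) (vel t) x.
  by apply: tr_prod_ge0 => //; exact: sv.1.
rewrite /L2 (integral_density _ _ _ m _ setT (fun x => Num.sqrt (det_rel A g (gam t) x)))//.
- by apply: eq_integral => x _; rewrite -EFinM sqr_sqrtr// mulr_ge0// sqrtr_ge0.
- exact: measurable_fun_sqrt.
- move=> E mE; rewrite setTI; apply: mh => //; first exact: metric_section.
  exact: (smooth_section_measurable _ _ mt.1).
- exact/measurable_EFinP.
Qed.

Lemma point_length_ge0 gam a p (x : M) : (0 <= point_length g gam a p x)%E.
Proof.
elim: p a => [//|[b vel] p IH] a /=; rewrite adde_ge0//.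
by apply: integral_ge0 => t _; rewrite lee_fin speed_ge0.
Qed.

Lemma path_length_ge0 gam a p : (0 <= path_length A gam a p)%E.
Proof.
elim: p a => [//|[b vel] p IH] a /=; rewrite adde_ge0//.
by apply: integral_ge0 => t _; exact: sqrte_ge0.
Qed.

Lemma measurable_point_length gam a p : piecewise_C1 A gam a p ->
  measurable_fun ([set: M] : set (lebM A)) (point_length g gam a p).
Proof.
elim: p a => [|[b vel] p IH] a /=; first by move=> _; exact: measurable_cst.
move=> [ab P /IH mp]; apply: emeasurable_funD => //.
have mc : measurable_fun ([set: M] : set (lebM A)) (cst 0 : M -> R).
  exact: measurable_cst.
by have [_] := weighted_length_le m a b (speed g gam vel) (cst 0) (ltW ab)
  (fun t x _ => speed_ge0 g gam vel t x)
  (fun t tab => measurable_speed _ _ _ _ _ _ mg P tab)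
  (fun x => continuous_speed _ _ _ _ _ x mg ab P) mc (fun=> lexx 0).
Qed.

Lemma weighted_point_length_le gam a p (q : M -> R) : piecewise_C1 A gam a p ->
  measurable_fun ([set: M] : set (lebM A)) q -> (forall x, 0 <= q x) ->
  (\int[m]_x ((q x)%:E * point_length g gam a p x) <=
   sqrte (\int[m]_x (q x ^+ 2)%:E) * path_length A gam a p)%E.
Proof.
move=> + mq q0; elim: p a => [|[b vel] p IH] a.
  by move=> _ /=; rewrite mule0 integral0_eq// => x _; rewrite mule0.
move=> [ab P Pp]; have [W mI] := weighted_length_le m a b (speed g gam vel) q (ltW ab)
  (fun t x _ => speed_ge0 g gam vel t x)
  (fun t tab => measurable_speed _ _ _ _ _ _ mg P tab)
  (fun x => continuous_speed _ _ _ _ _ x mg ab P) mq q0.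
have I0 x : (0 <= \int[leb]_(t in `[a, b]) (speed g gam vel t x)%:E)%E.
  by apply: integral_ge0 => t _; rewrite lee_fin speed_ge0.
have mqE : measurable_fun ([set: M] : set (lebM A)) (EFin \o q).
  exact/measurable_EFinP.
rewrite [point_length _ _ _ _]/= [path_length _ _ _ _]/=.
under eq_integral => x _ do rewrite ge0_muleDr ?I0 ?point_length_ge0//.
rewrite ge0_integralD//; first last.
- by apply: emeasurable_funM => //; exact: measurable_point_length.
- by move=> x _; rewrite mule_ge0 ?lee_fin ?point_length_ge0.
- by apply: emeasurable_funM.
- by move=> x _; rewrite mule_ge0 ?lee_fin.
rewrite ge0_muleDr ?path_length_ge0//; last first.
  by apply: integral_ge0 => t _; exact: sqrte_ge0.
apply: leeD; last exact: IH.
apply: le_trans W _; rewrite le_eqVlt; apply/orP; left; apply/eqP; congr (_ * _)%E.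
apply: eq_integral => t /[!inE]; rewrite /= in_itv /= => tab.
by rewrite (L2_speed a b)//.
Qed.

(** Induction on the pieces: at the end of the first piece the root still exceeds d by
sqrt n times the length that remains. *)
Lemma point_length_step gam a p c (x : M) : piecewise_C1 A gam a p ->
  A c -> dom c x ->
  exists r, [/\ 0 <= r, point_length g gam a p x = r%:E &
    step_bound (\det (g c x))^-1 (gam a c x) (gam 1 c x) r].
Proof.
move=> + Ac cx; set k := (\det (g c x))^-1.
have k0 : 0 < k by rewrite invr_gt0; exact: metric_det_gt0 mg Ac cx.
elim: p a => [|[b vel] p IH] a.
  move=> /= ->; exists 0; split => //; split; first by rewrite subrr normr0 mulr0.
  by move=> u d _ _ _; rewrite subrr normr0 mulr0.
move=> [ab P /IH[r [r0 rE [rv rq]]]] /=.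
have Q := C1_on_posdef_path _ _ _ _ _ _ ab P Ac cx.
pose l := mx_length k a b (fun t => gam t c x) (fun t => vel t c x).
have l0 : 0 <= l by apply: Rintegral_ge0 => t _; exact: sqrtr_ge0.
have lE : (\int[leb]_(t in `[a, b]) (speed g gam vel t x)%:E = l%:E)%E.
  rewrite /l /mx_length /Rintegral fineK; last first.
    apply: integrable_fin_num => //.
    apply: continuous_compact_integrable; first exact: segment_compact.
    exact: continuous_mx_speed Q.
  apply: eq_integral => t /[!inE]; rewrite /= in_itv /= => tab.
  by rewrite (speed_chart _ a b _ _ _ c).
have lv := root4_det_variation k k0 _ _ _ _ Q.
exists (l + r); split; [by rewrite addr_ge0|by rewrite lE rE|split].
  have lvb := lv b; rewrite lexx ltW// in lvb.
  rewrite mulrDr (le_trans (ler_distD (root4_det k (gam b c x)) _ _))// addrC lerD// lvb//.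
move=> u d u0 d0 dk.
have lvb := lv b; rewrite lexx ltW// in lvb.
have := lvb isT; rewrite ler_distl => /andP[lvb1 lvb2].
rewrite mulrDr in dk.
rewrite (le_trans (ler_distD (ln (quad u (gam b c x))) _ _))// mulrDr addrC lerD//.
  apply: (quad_variation k a b (fun t => gam t c x) _ _ u Q u0 d0) => t tab.
  have := lv t tab; rewrite ler_distl => /andP[h _].
  apply: le_trans h; rewrite -/l lerBrDr; apply: le_trans dk.
  by rewrite addrA lerDl mulr_ge0// sqrtr_ge0.
apply: rq => //; apply: le_trans lvb1; rewrite -/l.
by rewrite lerBrDr; apply: le_trans dk; rewrite -addrA lerD2l addrC.
Qed.

End MetricPath.

(** * The pointwise limit *)

Lemma cvg_mx_unique (R : realType) (T : Type) (F : set_system T)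
    {FF : ProperFilter F} m n (S : T -> 'M[R]_(m, n)) (L K : 'M[R]_(m, n)) :
  S @ F --> L -> S @ F --> K -> L = K.
Proof.
move=> SL SK; apply/matrixP => i j.
exact: (cvg_unique (@Rhausdorff R) (proj1 (cvg_mxP _ _) SL i j)
  (proj1 (cvg_mxP _ _) SK i j)).
Qed.

Section LimitMetric.
Context {R : realType} {n : nat} {M : ptopologicalType} (A : set (chart R n M)).
Hypothesis A_cover : charts_cover A.
Variables (g : @field R n M) (mg : metric A g).
Variable (m : {finite_measure set (lebM A) -> \bar R}).
Hypothesis mh : forall h, section A h -> measurable_section A h ->
  forall E, measurable (E : set (lebM A)) ->
  (@volume _ _ _ A h E = \int[m]_(x in E) (Num.sqrt (det_rel A g h x))%:E)%E.
Variables (hs : nat -> @field R n M) (hs_metric : forall k, metric A (hs k)).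
Variables (gam : nat -> R -> @field R n M)
  (p : nat -> seq (R * (R -> @field R n M))).
Hypotheses (path : forall k, piecewise_C1 A (gam k) 0 (p k))
  (path0 : forall k x, eq_at A (gam k 0) (hs k) x)
  (path1 : forall k x, eq_at A (gam k 1) (hs k.+1) x)
  (path_fin : (\sum_(k <oo) path_length A (gam k) 0 (p k) < +oo)%E).
Implicit Types (x : M) (c : chart R n M).

(* Th is the total pointwise length of the paths; the sequence converges to a
   positive definite matrix on E. *)
Let th k x := point_length A g (gam k) 0 (p k) x.
Let Th x := (\sum_(k <oo) th k x)%E.
Let D := seq_deflated A g hs.
Let E : set M := [set x | (Th x < +oo)%E] `\` D.

Let limit_field : @field R n M :=
  fun c x => if x \in E then lim (hs j c x @[j --> \oo]) else 0.

Let th_ge0 k x : (0 <= th k x)%E.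
Proof. exact: point_length_ge0. Qed.

Let Th_ge0 x : (0 <= Th x)%E.
Proof. by apply: nneseries_ge0 => k _ _. Qed.

Let measurable_Th : measurable_fun ([set: M] : set (lebM A)) Th.
Proof.
apply: (ge0_emeasurable_sum (P := xpredT)) => [k x _ _|k _]; first exact: th_ge0.
exact: measurable_point_length.
Qed.

Let Th_square_integrable : (\int[m]_x (Th x * Th x) < +oo)%E.
Proof.
apply: (sum_square_integrable m th (fun k => path_length A (gam k) 0 (p k))) => //.
- by move=> k; exact: measurable_point_length.
- by move=> k; exact: path_length_ge0.
- by move=> k q mq q0; exact: weighted_point_length_le.
Qed.

Let Th_pinfty_negligible : m.-negligible [set x | ~ (Th x < +oo)%E].
Proof.
have iTh : m.-integrable setT (fun x => Th x * Th x)%E.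
  apply/integrableP; split; first exact: emeasurable_funM.
  by under eq_integral do rewrite gee0_abs ?mule_ge0//.
have [N [mN N0 HN]] := integrable_ae measurableT iTh.
exists N; split => // x /= Thx; apply: HN => /= /(_ I).
have := Th_ge0 x; case: (Th x) Thx => [r|_ _|//]; first by rewrite ltry.
by rewrite mulyy.
Qed.

Let measurable_D : measurable (D : set (lebM A)).
Proof.
rewrite (_ : D = \bigcap_j \bigcup_k
   [set x | det_rel A g (hs k) x < j.+1%:R^-1]); last first.
  apply/seteqP; split=> [x Dx j _|x Dx d d0].
    have [|k Hk] := Dx j.+1%:R^-1; first by rewrite invr_gt0.
    by exists k.
  have [j dj] := ltr_add_invr d0.
  have [k _ Hk] := Dx j I; exists k; apply: lt_trans dj; by rewrite add0r.
apply: bigcap_measurableType => j _; apply: bigcup_measurable => k _.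
rewrite -[X in measurable X]setTI.
have mk := measurable_det_rel A g (hs k) mg (metric_section _ _ (hs_metric k))
  (smooth_section_measurable _ _ (hs_metric k).1).
have := mk measurableT `]-oo, j.+1%:R^-1[%classic (measurable_itv _).
rewrite (_ : [set x | _] = det_rel A g (hs k) @^-1` `]-oo, j.+1%:R^-1[%classic)//.
Qed.

Let measurable_E : measurable (E : set (lebM A)).
Proof.
apply: measurableD => //.
rewrite (_ : [set x | _] = ~` ([set: M] `&` Th @^-1` [set +oo%E])).
  by apply: measurableC; apply: measurable_Th => //; exact: emeasurable_set1.
apply/seteqP; split => x /=; rewrite ltey; first by move=> /eqP Thx [].
by move=> Thx; apply/eqP => Thy; apply: Thx.
Qed.

Let limit_fieldP c x : A c -> dom c x -> E x ->
  [/\ hs j c x @[j --> \oo] --> limit_field c x,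
      (limit_field c x)^T = limit_field c x,
      pos_def (limit_field c x) &
      root4_det (\det (g c x))^-1 (limit_field c x) <=
      root4_det (\det (g c x))^-1 (hs 0%N c x) + Num.sqrt n%:R * fine (Th x)].
Proof.
move=> Ac cx Ex; have [Thx Dx] := Ex.
set k := (\det (g c x))^-1.
have /choice[r Hr] : forall j, exists r, [/\ 0 <= r, th j x = r%:E &
    step_bound k (hs j c x) (hs j.+1 c x) r].
  move=> j; have [r [r0 rE]] := point_length_step A _ mg _ _ _ _ x (path j) Ac cx.
  by rewrite (path0 j x c Ac cx) (path1 j x c Ac cx) => rs; exists r.
(* Outside the deflated set the determinants have a positive lower bound. *)
have [d0 [d0_gt0 Hd]] : exists d, 0 < d /\ forall j, d <= det_rel A g (hs j) x.
  apply: contrapT => H; apply: Dx => d d_gt0; apply: contrapT => Hd; apply: H.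
  exists d; split => // j; rewrite leNgt; apply/negP => jd; apply: Hd.
  by exists j.
have rsum N : \sum_(0 <= j < N) r j <= fine (Th x).
  rewrite -lee_fin fineK ?ge0_fin_numE// -sumEFin.
  under eq_bigr => j _ do have [_ <- _] := Hr j.
  by apply: nneseries_lim_ge => j _ _; exact: th_ge0.
have dS j : Num.sqrt (Num.sqrt d0) <= root4_det k (hs j c x).
  rewrite /root4_det !ler_wsqrtr//; have := Hd j.
  rewrite (det_relE A _ _ c)//; [exact: metric_section..|].
  exact: metric_unit mg Ac cx.
have [L [SL sL pL vL]] := posdef_seq_cvg k (fun j => hs j c x) r (fine (Th x)) _
  (fun j => (metric_section _ _ (hs_metric j)).1 c x Ac cx)
  (fun j => metric_pos A _ _ _ (hs_metric j) Ac cx)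
  (fun j => let: And3 _ _ s := Hr j in s)
  (fun j => let: And3 s _ _ := Hr j in s) rsum
  (eq_ind_r is_true isT (etrans (sqrtr_gt0 _) (etrans (sqrtr_gt0 _) d0_gt0))) dS.
suff -> : limit_field c x = L by [].
have cL : cvg (hs j c x @[j --> \oo]) by apply/cvg_ex; exists L.
rewrite /limit_field mem_set//; exact: cvg_mx_unique cL SL.
Qed.

Let limit_field0 c x : ~ E x -> limit_field c x = 0.
Proof. by move=> Ex; rewrite /limit_field memNset. Qed.

Let limit_section : section A limit_field.
Proof.
split=> [c x Ac cx|c c' x Ac Ac' cx cx'].
  have [Ex|Ex] := pselect (E x); first by have [] := limit_fieldP c x Ac cx Ex.
  by rewrite limit_field0// trmx0.
have [Ex|Ex] := pselect (E x); last by rewrite !limit_field0// mulmx0 mul0mx.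
have [Lc _ _ _] := limit_fieldP c x Ac cx Ex.
have [Lc' _ _ _] := limit_fieldP c' x Ac' cx' Ex.
apply: cvg_mx_unique Lc _.
have Lj : jac c c' x *m hs j c' x *m (jac c c' x)^T @[j --> \oo] -->
    jac c c' x *m limit_field c' x *m (jac c c' x)^T.
  by apply: cvg_mulmx; [apply: cvg_mulmx => //|]; exact: cvg_cst.
apply: cvg_trans Lj; apply: near_eq_cvg; apply: nearW => j.
by rewrite ((metric_section _ _ (hs_metric j)).2 c c').
Qed.

Let limit_semimetric : semimetric A limit_field.
Proof.
split=> // x c Ac cx v.
have [Ex|Ex] := pselect (E x); last first.
  by rewrite limit_field0// mulmx0 mul0mx mxE.
have [->|v0] := eqVneq v 0; first by rewrite !mul0mx mxE.
by have [_ _ pL _] := limit_fieldP c x Ac cx Ex; exact/ltW/pL.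
Qed.

Let limit_measurable : measurable_section A limit_field.
Proof.
move=> c i j Ac.
have mc := open_measurable_lebM A _ (dom_open c).
(* Multiplied by the indicator of E, the components converge everywhere. *)
apply: (@measurable_fun_cvg _ (lebM A) _ _ (fun k x => hs k c x i j * \1_E x)).
- move=> k; apply: measurable_funM.
    exact: (smooth_section_measurable _ _ (hs_metric k).1).
  by apply: measurable_funTS; exact: measurable_indic.
- move=> x cx; have [Ex|Ex] := pselect (E x).
    have [Lc _ _ _] := limit_fieldP c x Ac cx Ex.
    under eq_fun do rewrite indicE mem_set// mulr1.
    exact: (proj1 (cvg_mxP _ _) Lc i j).
  under eq_fun do rewrite indicE memNset// mulr0.
  by rewrite limit_field0// mxE; exact: cvg_cst.
Qed.

(** Outside E the limit semimetric is 0, and det 0 is at most any positive determinant,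
with equality for n = 0.  On E this is the bound on the root, squared. *)
Let det_rel_limit_le x : (Th x < +oo)%E ->
  Num.sqrt (det_rel A g limit_field x) <=
  2 * Num.sqrt (det_rel A g (hs 0%N) x) + 2 * n%:R * fine (Th x) ^+ 2.
Proof.
move=> Thx; have [c Ac cx] := A_cover x.
have ug := metric_unit _ _ _ _ mg Ac cx.
have dg := metric_det_gt0 _ _ _ _ mg Ac cx.
rewrite !(det_relE A _ _ c)//; [|exact: metric_section..].
have [Ex|Ex] := pselect (E x); last first.
  apply: (@le_trans _ _ (Num.sqrt ((\det (g c x))^-1 * \det (hs 0%N c x)))).
    rewrite ler_wsqrtr// ler_wpM2l ?invr_ge0 ?(ltW dg)// limit_field0//.
    have := metric_det_gt0 _ _ _ _ (hs_metric 0%N) Ac cx.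
    move: (hs 0%N c x) => B; case: n B => [B|n' B B0]; first by rewrite !det_mx00.
    by rewrite det0 ltW.
  have s0 := sqrtr_ge0 ((\det (g c x))^-1 * \det (hs 0%N c x)).
  have t0 : 0 <= 2 * n%:R * fine (Th x) ^+ 2 by apply: mulr_ge0; [exact: mulr_ge0|exact: sqr_ge0].
  lra.
have [_ sL pL vL] := limit_fieldP c x Ac cx Ex.
set k := (\det (g c x))^-1 in vL *.
have vsq S : root4_det k S ^+ 2 = Num.sqrt (k * \det S).
  by rewrite sqr_sqrtr// sqrtr_ge0.
rewrite -!vsq; set v0 := root4_det k (hs 0%N c x) in vL *.
set t := fine (Th x) in vL *; set s := Num.sqrt n%:R in vL.
have -> : n%:R = s ^+ 2 by rewrite sqr_sqrtr.
have vL0 : 0 <= root4_det k (limit_field c x) by exact: sqrtr_ge0.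
apply: (@le_trans _ _ ((v0 + s * t) ^+ 2)).
  by rewrite ler_sqr ?nnegrE//; exact: le_trans vL.
have := sqr_ge0 (v0 - s * t).
lra.
Qed.

Let volume_limit_lty : (@volume _ _ _ A (hs 0%N) setT < +oo)%E ->
  (@volume _ _ _ A limit_field setT < +oo)%E.
Proof.
have s0 : section A (hs 0%N) by exact: metric_section.
have m0 : measurable_section A (hs 0%N).
  exact: (smooth_section_measurable _ _ (hs_metric 0%N).1).
rewrite !mh// => vol0.
pose rho h x := (Num.sqrt (det_rel A g h x))%:E.
have mrho h : section A h -> measurable_section A h ->
    measurable_fun ([set: M] : set (lebM A)) (rho h).
  move=> sh mh'; apply/measurable_EFinP; apply: measurable_fun_sqrt.
  exact: measurable_det_rel.
have rho0 h x : (0 <= rho h x)%E by rewrite lee_fin sqrtr_ge0.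
have C0 : (0 <= (2 * n%:R)%:E :> \bar R)%E by rewrite lee_fin mulr_ge0.
have mTT : measurable_fun ([set: M] : set (lebM A)) (fun x => Th x * Th x)%E.
  exact: emeasurable_funM.
apply: (@le_lt_trans _ _ (\int[m]_x (2%:E * rho (hs 0%N) x +
    (2 * n%:R)%:E * (Th x * Th x)))%E).
  have [N [mN N0 HN]] := Th_pinfty_negligible.
  apply: ae_ge0_le_integral => //.
  - exact: mrho.
  - by move=> x _; rewrite adde_ge0// mule_ge0// mule_ge0.
  - apply: emeasurable_funD; apply: measurable_funeM => //; exact: mrho.
  exists N; split => // x /= H; apply: HN => /= Thx; apply: H => _.
  rewrite -(fineK (_ : Th x \is a fin_num)) ?ge0_fin_numE//.
  rewrite /rho -!EFinM -EFinD lee_fin; have := det_rel_limit_le x Thx.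
  by rewrite expr2.
rewrite ge0_integralD//; last 4 first.
- by move=> x _; rewrite mule_ge0.
- by apply: measurable_funeM; exact: mrho.
- by move=> x _; rewrite mule_ge0// mule_ge0.
- by apply: measurable_funeM.
have T20 x : (0 <= Th x * Th x)%E by rewrite mule_ge0.
rewrite (ge0_integralZl m measurableT (mrho _ s0 m0))//.
rewrite (ge0_integralZl m measurableT mTT)//.
by apply: lte_add_pinfty; apply: lte_mul_pinfty.
Qed.

(** If theta is finite at a point of the deflated set of the sequence, the limit
semimetric is 0 there, which is not positive definite unless n = 0; but for n = 0
all determinants are 1 and the sequence is nowhere deflated. *)
Lemma summable_paths_limit : (@volume _ _ _ A (hs 0%N) setT < +oo)%E ->
  exists ginf N, [/\ Mf A ginf, m.-negligible N,
    forall x, ~ N x -> (seq_deflated A g hs x <-> deflated A ginf x) &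
    forall x, ~ N x -> ~ seq_deflated A g hs x ->
      at_point A (fun c => hs j c x @[j --> \oo] --> ginf c x) x].
Proof.
move=> vol0; exists limit_field, [set x | ~ (Th x < +oo)%E]; split => //.
- by split; [split|exact: volume_limit_lty].
- move=> x /contrapT Thx; split=> [Dx|/= dx]; last first.
    apply: contrapT => Dx; apply: dx => c Ac cx.
    by have [_ _ pL _] := limit_fieldP c x Ac cx (conj Thx Dx).
  move=> px; have [c Ac cx] := A_cover x.
  have /px/(_ cx) pc := Ac; rewrite limit_field0 in pc; last by case.
  have [d0] := Dx 1 ltr01; rewrite (det_relE A _ _ c)//; [|exact: metric_section..|]; last first.
    exact: metric_unit mg Ac cx.
  move: pc (g c x) (hs d0 c x); case: n => [_ B B'|n' pc B B' _].
    by rewrite !det_mx00 invr1 mulr1 ltxx.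
  have := pc (const_mx 1); rewrite mulmx0 mul0mx mxE ltxx => H.
  have : const_mx 1 != 0 :> 'rV[R]_n'.+1.
    by apply/eqP => /matrixP/(_ 0 0)/eqP; rewrite !mxE oner_eq0.
  by move=> /H.
- move=> x /contrapT Thx Dx c Ac cx.
  by have [Lc _ _ _] := limit_fieldP c x Ac cx (conj Thx Dx).
Qed.

End LimitMetric.

(** * Fast subsequences and the main theorem *)

Section Subsequence.
Context {R : realType} {n : nat} {M : ptopologicalType} (A : set (chart R n M)).
Implicit Types (gs : nat -> @field R n M).

Lemma dist_ge0 (g h : @field R n M) : (0 <= dist A g h)%E.
Proof.
by apply: le_ereal_inf_tmp => _ [gam [p [_ _ _ ->]]]; exact: path_length_ge0.
Qed.

Lemma increasing_ge_id (phi : nat -> nat) : {homo phi : m l / (m < l)%N} ->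
  forall k, (k <= phi k)%N.
Proof. by move=> mphi; elim=> // k IH; apply: leq_ltn_trans IH (mphi _ _ _). Qed.

Lemma dist_cauchy_subseq gs (phi : nat -> nat) : {homo phi : m l / (m < l)%N} ->
  dist_cauchy A gs -> dist_cauchy A (gs \o phi).
Proof.
move=> mphi cgs e /cgs[N HN]; exists N => m l Nm Nl.
by apply: HN; [apply: leq_trans Nm _|apply: leq_trans Nl _]; exact: increasing_ge_id.
Qed.

(** Adding k to the partial sums of the Cauchy thresholds makes the extraction strictly
increasing. *)
Lemma fast_subsequence gs : dist_cauchy A gs ->
  exists2 phi : nat -> nat, {homo phi : m l / (m < l)%N} &
    forall k, (dist A (gs (phi k)) (gs (phi k.+1)) < (1 / (2 ^ k.+1)%:R)%:E)%E.
Proof.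
move=> cgs.
have /choice[N HN] : forall k : nat, exists N : nat, forall m l : nat,
    (N <= m)%N -> (N <= l)%N -> (dist A (gs m) (gs l) < (1 / (2 ^ k.+1)%:R)%:E)%E.
  by move=> k; apply: cgs; rewrite divr_gt0// ltr0n expn_gt0.
pose phi k := (\sum_(i < k.+1) N i + k)%N.
have phiS k : (phi k < phi k.+1)%N.
  by rewrite /phi [in X in (_ < X)%N]big_ord_recr /= addnS ltnS leq_add2r leq_addr.
have Nphi k : (N k <= phi k)%N.
  by rewrite /phi big_ord_recr /= addnAC leq_addl.
exists phi; first by apply: homo_ltn => //; exact: ltn_trans.
move=> k; apply: HN => //; apply: leq_trans (Nphi k) _; exact: ltnW.
Qed.

Lemma negligible_eq_measure d (T : measurableType d) (mu nu : set T -> \bar R) N :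
  (forall E, measurable E -> mu E = nu E) -> mu.-negligible N -> nu.-negligible N.
Proof. by move=> E [B [mB B0 NB]]; exists B; split => //; rewrite -E. Qed.

End Subsequence.

Theorem theorem4p23 (R : realType) (n : nat) (M : ptopologicalType)
    (A : set (chart R n M))
    (M_hausdorff : hausdorff_space M)
    (M_compact : compact [set: M])
    (M_smooth : smooth_structure A)
    (M_orientable : orientable A)
    (g : field) (g_metric : metric A g)
    (gs : nat -> field) (gs_metric : forall k, metric A (gs k)) :
  dist_cauchy A gs ->
  exists2 C : set field, Mf_hat A g C & omega_subconverges A g gs C.
Proof.
move=> cgs; have [A_cover _ _] := M_smooth.
have [phi mphi fast] := fast_subsequence A gs cgs.
pose hs := gs \o phi.
have hs_metric k : metric A (hs k) by exact: gs_metric.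
have [m [mE mh]] := volume_measure A M_hausdorff g g_metric.
have to_vol N := negligible_eq_measure _ _ _ _ N mE.
have of_vol N := negligible_eq_measure _ _ _ _ N (fun E mE' => esym (mE E mE')).
have /choice[G HG] : forall k, exists G : (R -> @field R n M) * seq (R * (R -> @field R n M)),
    [/\ piecewise_C1 A G.1 0 G.2, forall x, eq_at A (G.1 0) (hs k) x,
        forall x, eq_at A (G.1 1) (hs k.+1) x &
        (path_length A G.1 0 G.2 < (1 / (2 ^ k.+1)%:R)%:E)%E].
  move=> k; have [_ [gam [p [P p0 p1 ->]]] lt] := ereal_inf_lt (fast k).
  by exists (gam, p).
have geom : (\sum_(k <oo) (1 / (2 ^ k.+1)%:R : R)%:E < +oo)%E.
  by apply: le_lt_trans (epsilon_trick0 xpredT ler01) _; exact: ltry.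
have path_fin : (\sum_(k <oo) path_length A (G k).1 0 (G k).2 < +oo)%E.
  apply: le_lt_trans geom; apply: lee_nneseries => k _; first by move=> _; exact: path_length_ge0.
  by have [_ _ _ /ltW] := HG k.
have vol0 : (@volume _ _ _ A (hs 0%N) setT < +oo)%E.
  have [m0 [m0E _]] := volume_measure A M_hausdorff _ (hs_metric 0%N).
  by rewrite -m0E// -ge0_fin_numE// fin_num_measure.
have [ginf [N [Mfg negN DN cN]]] := summable_paths_limit A A_cover g g_metric m mh hs
  hs_metric (fun k => (G k).1) (fun k => (G k).2)
  (fun k => let: And4 P _ _ _ := HG k in P) (fun k => let: And4 _ P _ _ := HG k in P)
  (fun k => let: And4 _ _ P _ := HG k in P) path_fin vol0.
exists (class A g ginf); first by exists ginf.
exists phi => //; split; first by exists ginf => //; case: Mfg.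
move=> ginf' [_ [defl_eq ae_eq]].
(* Another representative only differs from ginf on a further null set. *)
have negU := negligibleU (negligibleU negN (of_vol _ defl_eq)) (of_vol _ ae_eq).
split.
- exact: dist_cauchy_subseq.
- apply: to_vol; apply: negligibleS negU => x xD; left.
  have [|Nx] := pselect (N x); first by left.
  right; have DE := DN x Nx; case: xD => -[h1 h2]; [right|left]; split => //.
    by move=> /DE.
  exact/DE.
- apply: to_vol; apply: negligibleS negU => x /= H; apply: contrapT => Hx; apply: H.
  move=> Dx c Ac cx.
  have Nx : ~ N x by move=> Nx; apply: Hx; left; left.
  have dx : ~ deflated A ginf x by move=> /(DN x Nx).
  have dx' : ~ deflated A ginf' x.
    by move=> dx'; apply: Hx; left; right; right.
  suff <- : ginf c x = ginf' c x by exact: cN.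
  apply: contrapT => ne; apply: Hx; right => /= eq; apply: ne.
  by apply: eq => //; case.
- apply: le_lt_trans geom; apply: lee_nneseries => k _; first by move=> _; exact: dist_ge0.
  exact: ltW (fast k).
Qed.
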